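(* Let $N\geq 5$. For all $u\in C_{0}^{\infty}(\mathbb{R}^{N})$ we have: (a) $$\left(\int_{\mathbb{R}^{N}}|\Delta u|^{2}\,dx\right)^{\frac12}\left(\int_{\mathbb{R}^{N}}|x|^{2}|\nabla u|^{2}\,dx\right)^{\frac12}\geq\frac{N+2}{2}\int_{\mathbb{R}^{N}}|\nabla u|^{2}\,dx.$$ (b) $$\left(\int_{\mathbb{R}^{N}}|\Delta u|^{2}\,dx\right)^{\frac12}\left(\int_{\mathbb{R}^{N}}|\nabla u|^{2}\,dx\right)^{\frac12}\geq\frac{N+1}{2}\int_{\mathbb{R}^{N}}\frac{|\nabla u|^{2}}{|x|}\,dx.$$ (c) For every real $b<1$, $$\left(\int_{\mathbb{R}^{N}}|\Delta u|^{2}\,dx\right)^{\frac12}\left(\int_{\mathbb{R}^{N}}\frac{|\nabla u|^{2}}{|x|^{2b}}\,dx\right)^{\frac12}\geq\frac{N+1-b}{2}\int_{\mathbb{R}^{N}}\frac{|\nabla u|^{2}}{|x|^{b+1}}\,dx.$$ (d) For every real $b>1$, $$\left(\int_{\mathbb{R}^{N}}|\Delta u|^{2}\,dx\right)^{\frac12}\left(\int_{\mathbb{R}^{N}}\frac{|\nabla u|^{2}}{|x|^{2b}}\,dx\right)^{\frac12}\geq\frac{N+b-1}{2}\int_{\mathbb{R}^{N}}\frac{|\nabla u|^{2}}{|x|^{b+1}}\,dx.$$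
   Context: $C_0^\infty(\mathbb{R}^N)$ is the space of smooth functions with compact support in $\mathbb{R}^N$. Integrals of nonnegative functions are understood with values in $[0,\infty]$ (in (d) they may be infinite). *)

(* Defs.v *)
From HB Require Import structures.
From mathcomp Require Import all_boot all_order all_algebra.
From mathcomp Require Import all_classical all_reals all_analysis.

Set Implicit Arguments.
Unset Strict Implicit.
Unset Printing Implicit Defensive.
Import Order.TTheory GRing.Theory Num.Theory.
Import numFieldNormedType.Exports.

Local Open Scope classical_set_scope.
Local Open Scope ring_scope.

(* Points of R^n are row vectors 'rV[R]_n, with the topology and derivatives of
   the library. The sigma-algebra is the one generated by the coordinates, as
   the library does for tuples; since R is second countable it is the Borel
   sigma-algebra of R^n. *)
Definition measure_rV_display : measure_display. Proof. exact. Qed.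

Section measurable_rV.
Context {R : realType} (n : nat).

Let coors : 'I_n -> 'rV[R]_n -> R := fun i x => x ord0 i.

Let rV_set0 : g_sigma_preimage coors set0.
Proof. exact: sigma_algebra0. Qed.

Let rV_setC A : g_sigma_preimage coors A -> g_sigma_preimage coors (~` A).
Proof. exact: sigma_algebraC. Qed.

Let rV_bigcup (F : (set 'rV[R]_n)^nat) :
  (forall i, g_sigma_preimage coors (F i)) ->
  g_sigma_preimage coors (\bigcup_i (F i)).
Proof. exact: sigma_algebra_bigcup. Qed.

HB.instance Definition _ := @isMeasurable.Build measure_rV_display
  'rV[R]_n (g_sigma_preimage coors) rV_set0 rV_setC rV_bigcup.

Lemma measurable_coord (i : 'I_n) :
  measurable_fun [set: 'rV[R]_n] (fun x : 'rV[R]_n => x ord0 i).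
Proof.
move=> _ Y mY; rewrite setTI; apply: sub_sigma_algebra => /=.
rewrite -bigcup_seq/=; exists i => /=; first by rewrite mem_index_enum.
by exists Y => //; rewrite setTI.
Qed.

Lemma measurable_fun_coordP d (T : measurableType d) (f : T -> 'rV[R]_n) :
  (forall i, measurable_fun [set: T] (fun t => f t ord0 i)) ->
  measurable_fun [set: T] f.
Proof.
move=> mf; suff H : g_sigma_preimage (fun i => coors i \o f) `<=` measurable.
  move=> _ A mA; apply: H; rewrite g_sigma_preimage_comp; by exists A.
apply: smallest_sub; first exact: sigma_algebra_measurable.
move=> A; rewrite -bigcup_seq/= => -[i _ [B mB <-]]; exact: mf.
Qed.

End measurable_rV.

Section rV_cons.
Context {R : realType} (n : nat).

Definition rV_cons (p : R * 'rV[R]_n) : 'rV[R]_n.+1 :=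
  row_mx (const_mx p.1 : 'rV[R]_1) p.2.

Definition rV_uncons (x : 'rV[R]_n.+1) : R * 'rV[R]_n :=
  (x ord0 ord0, rsubmx (x : 'rV[R]_(1 + n))).

Lemma rV_cons0 p : rV_cons p ord0 ord0 = p.1.
Proof.
have -> : ord0 = lshift n (ord0 : 'I_1) :> 'I_n.+1 by exact: val_inj.
by apply: etrans (row_mxEl _ _ _ _) _; rewrite mxE.
Qed.

Lemma rV_consS p i : rV_cons p ord0 (lift ord0 i) = p.2 ord0 i.
Proof.
have -> : lift ord0 i = rshift 1 i :> 'I_n.+1 by exact: val_inj.
exact: row_mxEr.
Qed.

Lemma rV_consK : cancel rV_cons rV_uncons.
Proof.
move=> [x y]; rewrite /rV_uncons rV_cons0; congr pair; exact: row_mxKr.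
Qed.

Lemma rV_unconsK : cancel rV_uncons rV_cons.
Proof.
move=> x; apply/rowP => i; case: (unliftP ord0 i) => [j|] ->.
  rewrite rV_consS /= mxE; congr (x _ _); exact: val_inj.
by rewrite rV_cons0.
Qed.

Lemma measurable_rV_cons : measurable_fun setT rV_cons.
Proof.
apply: measurable_fun_coordP => i; case: (unliftP ord0 i) => [j|] ->.
  rewrite (_ : (fun t => _) = (fun x : 'rV[R]_n => x ord0 j) \o snd).
    apply: measurableT_comp; [exact: measurable_coord | exact: measurable_snd].
  by apply/funext => t; rewrite rV_consS.
rewrite (_ : (fun t => _) = fst); first exact: measurable_fst.
by apply/funext => t; rewrite rV_cons0.
Qed.

Lemma measurable_rV_uncons : measurable_fun setT rV_uncons.
Proof.
apply: measurable_fun_pair; first exact: measurable_coord.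
apply: measurable_fun_coordP => i.
rewrite (_ : (fun t => _) = (fun x : 'rV[R]_n.+1 => x ord0 (rshift 1 i))).
  exact: measurable_coord.
by apply/funext => t; rewrite mxE.
Qed.

HB.instance Definition _ := isMeasurableFun.Build _ _ _ _ rV_cons
  measurable_rV_cons.

End rV_cons.

Section lebesgue_rV_step.
Context {R : realType} (n : nat).
Variable mu : {sigma_finite_measure set 'rV[R]_n -> \bar R}.

Definition lebesgue_rV_step : set 'rV[R]_n.+1 -> \bar R :=
  pushforward (lebesgue_measure \x mu)%E (@rV_cons R n).

Let step0 : lebesgue_rV_step set0 = 0%E.
Proof. by have mf := @measurable_rV_cons R n; exact: measure0. Qed.

Let step_ge0 A : (0 <= lebesgue_rV_step A)%E.
Proof. by have mf := @measurable_rV_cons R n; exact: measure_ge0. Qed.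

Let step_sigma_additive : semi_sigma_additive lebesgue_rV_step.
Proof. by have mf := @measurable_rV_cons R n; exact: measure_semi_sigma_additive. Qed.

HB.instance Definition _ := isMeasure.Build _ _ _ lebesgue_rV_step
  step0 step_ge0 step_sigma_additive.

Let sigma_finite_step : sigma_finite setT lebesgue_rV_step.
Proof.
have /sigma_finiteP[F [TF ndF Foo]] := sigma_finiteT (@lebesgue_measure R).
have /sigma_finiteP[G [TG ndG Goo]] := sigma_finiteT mu.
exists (fun i => @rV_uncons R n @^-1` (F i `*` G i)).
  apply/esym; rewrite -preimage_bigcup -subTset => x _.
  have [k _ Fk] : (\bigcup_k F k) (rV_uncons x).1 by rewrite -TF.
  have [l _ Gl] : (\bigcup_k G k) (rV_uncons x).2 by rewrite -TG.
  exists (maxn k l) => //; split.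
    by move: Fk; exact/subsetPset/ndF/leq_maxl.
  by move: Gl; exact/subsetPset/ndG/leq_maxr.
move=> i; have [mF Fi] := Foo i; have [mG Gi] := Goo i; split.
  rewrite -[X in measurable X]setTI; apply: measurable_rV_uncons => //.
  exact: measurableX.
rewrite /lebesgue_rV_step /pushforward -comp_preimage.
rewrite (_ : _ \o _ = id); last by apply/funext => p /=; rewrite rV_consK.
by rewrite preimage_id product_measure1E// lte_mul_pinfty// ge0_fin_numE.
Qed.

HB.instance Definition _ := Measure_isSigmaFinite.Build _ _ _
  lebesgue_rV_step sigma_finite_step.

End lebesgue_rV_step.

(* Lebesgue measure on R^n: the n-fold product of the one of R *)
Fixpoint lebesgue_rV (R : realType) (n : nat) :
    {sigma_finite_measure set 'rV[R]_n -> \bar R} :=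
  match n with
  | 0 => \d_(0 : 'rV[R]_0)
  | m.+1 => lebesgue_rV_step (lebesgue_rV R m)
  end.

Lemma lebesgue_rV_box (R : realType) (n : nat) (A : 'I_n -> set R) :
  (forall i, measurable (A i)) ->
  lebesgue_rV R n [set x | forall i, A i (x ord0 i)] =
    (\prod_(i < n) lebesgue_measure (A i))%E.
Proof.
elim: n A => [|n IH] A mA.
  rewrite big_ord0 /= diracE mem_set//; by case.
rewrite big_ord_recl -IH //= /lebesgue_rV_step /pushforward.
rewrite -product_measure1E//.
  congr (_ _); apply/seteqP; split => [[x y]/= H|[x y]/= [H0 H] i].
    split; first by have := H ord0; rewrite rV_cons0.
    by move=> i; have := H (lift ord0 i); rewrite rV_consS.
  by case: (unliftP ord0 i) => [j|] ->; rewrite (rV_cons0, rV_consS).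
  exact: mA.
rewrite [X in measurable X](_ : _ =
    \bigcap_(i in [set: 'I_n])
      ((fun y : 'rV[R]_n => y ord0 i) @^-1` A (lift ord0 i))); last first.
  by apply/seteqP; split => y /= H i; [move=> _; exact: H | exact: (H i)].
apply: fin_bigcap_measurable => //= i _.
by rewrite -[X in measurable X]setTI; exact: measurable_coord.
Qed.

Section euclidean_calculus.
Context {R : realType} {n : nat}.
Implicit Types (f u : 'rV[R]_n -> R) (x : 'rV[R]_n) (i : 'I_n).

(* The library norm `|x| on 'rV[R]_n is the sup norm. *)
Definition enorm x : R := Num.sqrt (\sum_(i < n) x ord0 i ^+ 2).

Definition partial i f : 'rV[R]_n -> R := fun x => 'D_(delta_mx ord0 i) f x.

Definition gradient u x : 'rV[R]_n := \row_(i < n) partial i u x.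

Definition laplacian u x : R := \sum_(i < n) partial i (partial i u) x.

(* C^oo: the iterated partial derivatives of all orders exist and are
   continuous. As 'D_v is total, existence is the derivability clause. *)
Definition smooth f : Prop :=
  forall s : seq 'I_n,
    continuous (foldr partial f s) /\
    forall i x, derivable (foldr partial f s) x (delta_mx ord0 i).

Definition compactly_supported f : Prop :=
  compact (closure [set x | f x != 0]).

End euclidean_calculus.

(* Main.v *)
Require Import Defs.
From mathcomp Require Import all_boot all_order all_algebra.
From mathcomp Require Import all_classical all_reals all_analysis.
From mathcomp Require Import measurable_realfun ring lra.

(** Let A be the integral of (Delta u)^2 and let E(s) be the integral of
    |grad u|^2 / |x|^s. All four inequalities are instances of
      (N + |1 - b|) / 2 * E(b + 1) <= A^(1/2) * E(2b)^(1/2)      (lemma ckn),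
    with b = -1 for (a) and b = 0 for (b). When E(2b) is finite this follows by
    optimizing over l > 0 the quadratic inequality
      l (N + |1 - b|) E(b + 1) <= A + l^2 E(2b).

    The quadratic inequality is obtained by completing squares, up to divergences.
    Put r = |x|, theta = x / r, g = grad u, H = Hess u, and let p = theta . g be the
    radial derivative. For a radial function u it suffices to
    integrate the square of
      theta . H theta + c p / r + m r^(-b) p,
    with c = -1 and m > 0 if b < 1, and with c = N - 1 and m < 0 if b > 1.
    For a general u there are three more ingredients.
    - The integrals of (Delta u)^2 and of |H|^2 coincide, and the trace inequality
      for the part of H tangent to the spheres (hessian_sqr_ge) then bounds A from
      below by radial terms and by tangential ones. This plays the role of the
      spectral gap of the Laplacian of the sphere.
    - The tangential part of g is controlled by the tangential part of
      al (H theta + g / r) + (be / r + m r^(-b)) g, through Cauchy-Schwarz against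
      theta, for suitable constants al and be (pointwise_certificate).
    - With the best constants the remaining coefficient is (N^2 - 4 N - 4) / 4,
      which is where N >= 5 enters.

    The divergences are those of the fields g Delta u - H g, r^(-b-1) |g|^2 x,
    r^(-b-3) (x . g)^2 x, the last two also with b = 1, and
    r^(-2) ((x . H x) g - (g . H x) x). Most of them are singular at the origin,
    but almost every line parallel to an axis avoids it, so that Fubini and the
    fundamental theorem of calculus give the vanishing of their integrals as soon
    as the derivatives are integrable (integral_partial_eq0).
    Integrability follows from that of r^(-2) on bounded sets and from the
    finiteness of E(2b), since every term is a product of two square integrable
    functions. If E(2b) is infinite there is nothing to prove unless Delta u = 0,
    and then grad u = 0 by the case b = -1. *)

Set Implicit Arguments.
Unset Strict Implicit.
Unset Printing Implicit Defensive.
Import Order.TTheory GRing.Theory Num.Theory.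
Import numFieldNormedType.Exports.

Local Open Scope classical_set_scope.
Local Open Scope ring_scope.

(** * Measurability on row vectors *)

Section measure_rV.
Context {R : realType}.

Lemma measurable_rV0 n : measurable [set 0 : 'rV[R]_n].
Proof.
rewrite (_ : [set 0 : 'rV[R]_n] = \bigcap_(i in [set: 'I_n])
   ((fun y : 'rV[R]_n => y ord0 i) @^-1` [set 0])).
  apply: fin_bigcap_measurable => //= i _.
  by rewrite -[X in measurable X]setTI; exact: measurable_coord.
apply/seteqP; split => [x -> i _ /=|x Hx /=]; first by rewrite mxE.
by apply/rowP => i; rewrite mxE; exact: Hx.
Qed.

(** Neighbourhoods for the matrix topology are coordinatewise; this form keeps
    the sup norm and the matrix balls out of the later proofs. *)
Lemma near_rV_coord n (x : 'rV[R]_n) (P : set 'rV[R]_n) :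
  (\forall y \near x, P y) ->
  exists2 e : R, 0 < e & forall y : 'rV[R]_n,
    (forall i, `|x ord0 i - y ord0 i| < e) -> P y.
Proof.
move=> /nbhs_ballP[e e0 He]; exists e => // y Hy; apply: He.
split => //= i j; rewrite (ord1 i); exact: Hy.
Qed.

(** The sigma-algebra is generated by the coordinates, so open sets are not
    measurable by definition. Rounding the coordinates of the argument down to
    multiples of 1/(k+1) gives measurable functions, because they factor through
    a countable set, and they converge to f wherever f is continuous. One
    exceptional point is allowed because the functions used below are singular
    at the origin. *)
Lemma measurable_continuous_off0 n (f : 'rV[R]_n -> R) :
  (forall x, x != 0 -> {for x, continuous f}) -> measurable_fun setT f.
Proof.
move=> cf.
pose q (k : nat) (v : {ffun 'I_n -> int}) : 'rV[R]_n :=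
  \row_i ((v i)%:~R / k.+1%:R).
pose a (k : nat) (x : 'rV[R]_n) : {ffun 'I_n -> int} :=
  [ffun i => Num.floor (x ord0 i * k.+1%:R)].
have m0 := @measurable_rV0 n.
have mD : measurable (~` [set (0 : 'rV[R]_n)]) by exact: measurableC.
suff H : measurable_fun (~` [set (0 : 'rV[R]_n)]) f.
  rewrite -(setvU [set (0 : 'rV[R]_n)]); apply/measurable_funU => //; split => //.
  exact: measurable_fun_set1.
apply: (@measurable_fun_cvg _ _ _ _ (fun k x => f (q k (a k x)))).
  move=> k; apply: measurable_funTS => _ Y mY; rewrite setTI.
  have ma v : measurable (a k @^-1` [set v]).
    rewrite (_ : _ @^-1` _ = \bigcap_(i in [set: 'I_n])
     ((fun y : 'rV[R]_n => y ord0 i * k.+1%:R) @^-1` [set t | Num.floor t = v i])).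
      apply: fin_bigcap_measurable => //= i _.
      rewrite -[X in measurable X]setTI.
      apply: (measurable_funM (measurable_coord i) (measurable_cst _)) => //.
      rewrite (_ : mkset _ = `[(v i)%:~R, (v i + 1)%:~R[%classic); first exact: measurable_itv.
      apply/seteqP; split => t /=; rewrite in_itv /=.
        by move=> <-; exact: floor_itv.
      exact: floor_def.
    apply/seteqP; split => x /= Hx; first by move=> i _ /=; rewrite -Hx ffunE.
    by apply/ffunP => i; rewrite ffunE; exact: Hx.
  rewrite (_ : _ @^-1` Y = \bigcup_v (if asbool (Y (f (q k v))) then a k @^-1` [set v] else set0)).
    apply: countable_bigcupT_measurable => [|v]; first exact: countableP.
    by case: ifP.
  apply/seteqP; split => x /=; first by move=> Hx; exists (a k x) => //; rewrite asboolT.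
  by case=> v _; case: asboolP => //= Hv ->.
move=> x /eqP x0.
have /cvgrPdist_lt Hc := cf x x0.
apply/cvgrPdist_lt => e e0; have /near_rV_coord[d d0 Hd] := Hc e e0.
near=> k; apply: Hd => i.
rewrite mxE ffunE; set t := x ord0 i.
have k0 : (0 : R) < k.+1%:R by rewrite ltr0n.
have /andP[h1 h2] : (Num.floor (t * k.+1%:R))%:~R <= t * k.+1%:R < (Num.floor (t * k.+1%:R))%:~R + 1.
  by have := floor_itv (t * k.+1%:R); rewrite intrD.
have h3 : 0 <= t - (Num.floor (t * k.+1%:R))%:~R / k.+1%:R.
  by rewrite subr_ge0 ler_pdivrMr.
rewrite ger0_norm //.
have : t - (Num.floor (t * k.+1%:R))%:~R / k.+1%:R <= k.+1%:R^-1.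
  by rewrite lerBlDr -[X in _ <= X + _]mul1r -mulrDl ler_pdivlMr // addrC ltW.
move/le_lt_trans; apply.
near: k.
exact: (near_infty_natSinv_lt (PosNum d0)).
Unshelve. all: by end_near. Qed.

End measure_rV.

(** * Integration against Lebesgue measure on row vectors *)

Section lebesgue_rV_theory.
Context {R : realType}.

Lemma lebesgue_rV0 n : (0 < n)%N -> lebesgue_rV R n [set 0 : 'rV[R]_n] = 0%E.
Proof.
case: n => // n _.
have -> : [set 0 : 'rV[R]_n.+1] = [set x | forall i, [set 0] (x ord0 i)].
  apply/seteqP; split => x /= Hx; first by rewrite Hx => i; rewrite mxE.
  by apply/rowP => i; rewrite mxE; exact: Hx.
apply: (etrans (lebesgue_rV_box (A := fun=> [set 0]) _)) => [//|].
by rewrite big_ord_recl; have /= -> := @lebesgue_measure_set1 R 0; rewrite mul0e.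
Qed.

Local Open Scope ereal_scope.

Lemma ge0_integral_rV_cons n (f : 'rV[R]_n.+1 -> \bar R) :
  measurable_fun setT f -> (forall x, 0 <= f x) ->
  \int[lebesgue_rV R n.+1]_x f x =
  \int[lebesgue_measure \x lebesgue_rV R n]_p f (rV_cons p).
Proof.
move=> mf f0; have mc : measurable_fun [set: measurableTypeR R * 'rV[R]_n] (@rV_cons R n).
  exact: measurable_rV_cons.
have := @ge0_integral_pushforward _ _ _ _ _ _ mc (lebesgue_measure \x lebesgue_rV R n) setT f.
rewrite preimage_setT. move=> /(_ measurableT mf (fun x _ => f0 x)). move=> H; exact: H.
Qed.

Lemma integrable_rV_cons n (f : 'rV[R]_n.+1 -> \bar R) :
  (lebesgue_rV R n.+1).-integrable setT f ->
  (lebesgue_measure \x lebesgue_rV R n)%E.-integrable setT (f \o (@rV_cons R n)).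
Proof.
move=> /integrableP[mf fi]; apply/integrableP; split.
  by apply: measurableT_comp => //; exact: measurable_rV_cons.
rewrite -(@ge0_integral_rV_cons n (fun x => `|f x|)) //.
exact: measurableT_comp.
Qed.

Lemma integral_rV_cons n (f : 'rV[R]_n.+1 -> \bar R) :
  (lebesgue_rV R n.+1).-integrable setT f ->
  \int[lebesgue_rV R n.+1]_x f x =
  \int[lebesgue_measure \x lebesgue_rV R n]_p f (rV_cons p).
Proof.
move=> fi; have mc : measurable_fun [set: measurableTypeR R * 'rV[R]_n] (@rV_cons R n).
  exact: measurable_rV_cons.
have fi' := integrable_rV_cons fi.
apply: (@integral_pushforward _ _ _ _ _ _ mc (lebesgue_measure \x lebesgue_rV R n) setT f) => //.
exact: measurable_int fi.
Qed.

End lebesgue_rV_theory.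

(** * Integrals of partial derivatives *)

Section integral_partial.
Context {R : realType}.

(** Difference quotients are transported by any map that sends the line through
    x with direction v to the line through its image with direction w; slices of
    a function on R^n.+1 and restrictions to lines are the two uses. *)
Lemma is_derive_affine (V W : normedModType R) (phi : V -> W) (f : W -> R)
    (x v : V) (w : W) (l : R) :
  (forall h : R, phi (h *: v + x) = h *: w + phi x) ->
  is_derive (phi x) w f l -> is_derive x v (f \o phi) l.
Proof.
move=> phiE [df dl].
have E : (fun h : R => h^-1 *: (((f \o phi) \o shift x) (h *: v) - (f \o phi) x)) =
         (fun h : R => h^-1 *: ((f \o shift (phi x)) (h *: w) - f (phi x))).
  by apply/funext => h; rewrite /= phiE.
by split; [rewrite /derivable E | rewrite /derive E].
Qed.

Lemma cvg_rV n (T : Type) (F : set_system T) {FF : Filter F}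
    (phi : T -> 'rV[R]_n) (a : 'rV[R]_n) :
  (forall i, phi z ord0 i @[z --> F] --> a ord0 i) -> phi @ F --> a.
Proof.
move=> H P /near_rV_coord[e e0 He].
have : \forall z \near F, forall i, `|a ord0 i - phi z ord0 i| < e.
  by apply: filter_forall => i; have /cvgrPdist_lt := H i; exact.
by apply: filterS => z /He.
Qed.

Lemma rV_consZD n (h t : R) (y : 'rV[R]_n) :
  rV_cons (h *: (1 : R) + t, y) = h *: delta_mx ord0 ord0 + rV_cons (t, y).
Proof.
apply/rowP => i; rewrite [RHS]mxE [X in _ = X + _]mxE [X in _ = _ * X + _]mxE; case: (unliftP ord0 i) => [j|] ->.
  by rewrite !rV_consS /= mulr0 add0r.
by rewrite !rV_cons0 /= mulr1 /GRing.scale /= mulr1.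
Qed.

Lemma rV_consDZ n (h t : R) (y : 'rV[R]_n) (j : 'I_n) :
  rV_cons (t, h *: delta_mx ord0 j + y) =
  h *: delta_mx ord0 (lift ord0 j) + rV_cons (t, y).
Proof.
apply/rowP => i; rewrite [RHS]mxE [X in _ = X + _]mxE [X in _ = _ * X + _]mxE; case: (unliftP ord0 i) => [k|] ->.
  by rewrite !rV_consS !mxE /= (inj_eq (@lift_inj _ _)).
by rewrite !rV_cons0 /= mulr0 add0r.
Qed.

Lemma continuous_rV_consl n (y : 'rV[R]_n) :
  continuous (fun t : R => rV_cons (t, y)).
Proof.
move=> t; apply: cvg_rV => i; case: (unliftP ord0 i) => [k|] ->.
  rewrite rV_consS (_ : (fun _ => _) = cst (y ord0 k)); first exact: cvg_cst.
  by apply/funext => z; rewrite rV_consS.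
rewrite rV_cons0 (_ : (fun _ => _) = id); first exact: cvg_id.
by apply/funext => z; rewrite rV_cons0.
Qed.

Lemma continuous_rV_consr n (t : R) :
  continuous (fun y : 'rV[R]_n => rV_cons (t, y)).
Proof.
move=> y; apply: (@cvg_rV _ _ (nbhs y) (nbhs_filter y)) => i; case: (unliftP ord0 i) => [k|] ->.
  rewrite rV_consS (_ : (fun _ => _) = (fun z : 'rV[R]_n => z ord0 k)).
    exact: coord_continuous.
  by apply/funext => z; rewrite rV_consS.
rewrite rV_cons0 (_ : (fun _ => _) = cst t); first exact: cvg_cst.
by apply/funext => z; rewrite rV_cons0.
Qed.

(** The fundamental theorem of calculus on an interval containing the support. *)
Lemma integral_derive_eq0 (f df : R -> R) (M : R) :
  (forall t, is_derive t (1 : R) f (df t)) -> continuous df ->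
  (forall t, M < `|t| -> f t = 0) ->
  (\int[lebesgue_measure]_t (df t)%:E = 0)%E.
Proof.
move=> df1 cdf f0; pose A := `|M| + 1.
have A0 : 0 < A by rewrite ltr_pwDr.
have MA : M < A by rewrite (le_lt_trans (ler_norm M)) // ltrDl.
have df0 t : M < `|t| -> df t = 0.
  move=> Mt; have [_ <-] := df1 t.
  rewrite (near_eq_derive (1 : R) (g := cst 0)) ?derive_cst ?oner_neq0 //.
  have : \forall z \near t, M < `|z|.
    have : (fun z : R => `|z|) @ t --> `|t| by exact: norm_continuous.
    by move=> /cvgr_gt; apply.
  by apply: filterS => z /f0.
have -> : (fun t => (df t)%:E) = (fun t => (df t)%:E) \_ `[-A, A].
  apply/funext => t; rewrite /patch; case: ifPn => //.
  rewrite notin_setE /= in_itv /= => /negP; rewrite -ler_norml -ltNge => At.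
  by rewrite df0 // (lt_trans MA).
rewrite -integral_mkcond.
have cf : continuous f.
  by move=> t; apply/differentiable_continuous/derivable1_diffP; have [] := df1 t.
rewrite (@continuous_FTC2 _ df f).
- by rewrite !f0 ?normrN ?gtr0_norm // sube0.
- by rewrite gtrN.
- exact: continuous_subspaceT.
- split.
  + by move=> t _; have [] := df1 t.
  + exact/cvg_at_right_filter/cf.
  + exact/cvg_at_left_filter/cf.
- by move=> t _; rewrite derive1E; have [_ ->] := df1 t.
Qed.

Lemma ae_rV_neq0 n : {ae lebesgue_rV R n, forall x : 'rV[R]_n, forall k, x ord0 k != 0}.
Proof.
apply: filter_forall => k.
pose A (i : 'I_n) : set R := if i == k then [set 0] else setT.
exists [set x : 'rV[R]_n | forall i, A i (x ord0 i)]; split.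
- rewrite (_ : mkset _ = (fun y : 'rV[R]_n => y ord0 k) @^-1` [set 0]).
    by rewrite -[X in measurable X]setTI; exact: measurable_coord.
  apply/seteqP; split => x /=; first by move/(_ k); rewrite /A eqxx.
  by move=> Hx i; rewrite /A; case: eqP => // ->.
- apply: (etrans (lebesgue_rV_box (A := A) _)); first by move=> i; rewrite /A; case: ifP.
  rewrite (bigD1 k) //= {1}/A eqxx.
  by have /= -> := @lebesgue_measure_set1 R 0; rewrite mul0e.
- by move=> x /= /negP; rewrite negbK => /eqP Hx i; rewrite /A; case: eqP => // ->.
Qed.

Lemma ae_neq0 : {ae @lebesgue_measure R, forall t, t != 0}.
Proof.
exists [set 0]; split => //; first exact: lebesgue_measure_set1.
by move=> t /= /negP; rewrite negbK => /eqP.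
Qed.

(** By Fubini the integral is computed along the lines in direction i first, and
    on such a line it vanishes by the fundamental theorem of calculus.
    Regularity is required only on the lines in direction i along which no other
    coordinate vanishes, which are almost all of them: a field that is singular
    at the origin is therefore admissible as soon as its derivative is
    integrable. *)
Lemma integral_partial_eq0 n (i : 'I_n) (f df : 'rV[R]_n -> R) (M : R) :
  (forall x : 'rV[R]_n, (forall k, k != i -> x ord0 k != 0) ->
     is_derive x (delta_mx ord0 i : 'rV[R]_n) f (df x) /\
     {for x, continuous df}) ->
  (forall (x : 'rV[R]_n) k, M < `|x ord0 k| -> f x = 0) ->
  (lebesgue_rV R n).-integrable setT (EFin \o df) ->
  (\int[lebesgue_rV R n]_x (df x)%:E = 0)%E.
Proof.
elim: n i f df => [[]//|n IH] i f df Hd H0 Hi.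
rewrite (integral_rV_cons Hi).
have Hi' := integrable_rV_cons Hi.
case: (unliftP ord0 i) Hd => [j|] -> Hd.
  rewrite -(integral12_prod_meas1 Hi').
  rewrite (@ae_eq_integral _ _ _ _ setT (cst 0%E)) ?integral0 //.
    by have /integrableP[] := integrable_fubini_F Hi'.
  have ai := ae_integrable1 Hi'.
  apply: filterS2 ai ae_neq0 => t it t0 _.
  apply: (IH j (fun y => f (rV_cons (t, y))) (fun y => df (rV_cons (t, y)))) => //.
    move=> y Hy.
    have [|dy cy] := Hd (rV_cons (t, y)).
      move=> k; case: (unliftP ord0 k) => [l|] ->; last by rewrite rV_cons0.
      rewrite (inj_eq (@lift_inj _ _)) rV_consS; exact: Hy.
    split.
      apply: (@is_derive_affine _ _ (fun y => rV_cons (t, y)) f _ _ _ _ _ dy) => h.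
      exact: rV_consDZ.
    apply: (continuous_comp (f := fun y => rV_cons (t, y)) (g := df)) => //.
    exact: continuous_rV_consr.
  by move=> y k Hk; apply: (H0 _ (lift ord0 k)); rewrite rV_consS.
rewrite -(integral21_prod_meas1 Hi').
rewrite (@ae_eq_integral _ _ _ _ setT (cst 0%E)) ?integral0 //.
  exact: (measurable_fubini_G Hi').
apply: filterS (ae_rV_neq0 n) => y Hy _.
apply: (@integral_derive_eq0 (fun t => f (rV_cons (t, y))) (fun t => df (rV_cons (t, y))) M).
- move=> t; have [|dy _] := Hd (rV_cons (t, y)).
    by move=> k; case: (unliftP ord0 k) => [l|] -> //; rewrite rV_consS.
  apply: (@is_derive_affine _ _ (fun t : R => rV_cons (t, y)) f _ _ _ _ _ dy) => h.
  exact: rV_consZD.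
- move=> t; have [|_ cy] := Hd (rV_cons (t, y)).
    by move=> k; case: (unliftP ord0 k) => [l|] -> //; rewrite rV_consS.
  apply: (continuous_comp (f := fun t => rV_cons (t, y)) (g := df)) => //.
  exact: continuous_rV_consl.
- by move=> t Ht; apply: (H0 _ ord0); rewrite rV_cons0.
Qed.

End integral_partial.

(** * The Euclidean norm and its inverse square *)

Lemma continuous_sum (R : realType) (T : topologicalType) (I : Type) (r : seq I)
    (f : I -> T -> R) (x : T) :
  (forall i, {for x, continuous (f i)}) ->
  {for x, continuous (fun y => \sum_(i <- r) f i y)}.
Proof.
move=> cf; elim: r => [|i r IH].
  rewrite (_ : (fun _ => _) = cst 0); first exact: cst_continuous.
  by apply/funext => y; rewrite big_nil.
rewrite (_ : (fun _ => _) = (f i) \+ (fun y => \sum_(j <- r) f j y)).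
  exact: cvgD (cf i) IH.
by apply/funext => y; rewrite big_cons.
Qed.

Section enorm_theory.
Context {R : realType} (n : nat).
Implicit Types x : 'rV[R]_n.

Lemma sqr_enorm x : enorm x ^+ 2 = \sum_i x ord0 i ^+ 2.
Proof. by rewrite sqr_sqrtr // sumr_ge0 // => i _; exact: sqr_ge0. Qed.

Lemma enorm_ge0 x : 0 <= enorm x. Proof. exact: sqrtr_ge0. Qed.

Lemma coord_le_enorm x i : `|x ord0 i| <= enorm x.
Proof.
rewrite -(ler_pXn2r (n := 2)) ?nnegrE ?enorm_ge0 // sqr_enorm real_normK ?num_real //.
by rewrite (bigD1 i) //= lerDl sumr_ge0 // => j _; exact: sqr_ge0.
Qed.

Lemma enorm_gt0 x : x != 0 -> 0 < enorm x.
Proof.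
move=> x0; rewrite lt_neqAle enorm_ge0 andbT; apply: contraNneq x0 => e0.
by apply/eqP/rowP => i; apply/eqP; rewrite mxE -normr_le0 e0 coord_le_enorm.
Qed.

Lemma enorm0 : enorm (0 : 'rV[R]_n) = 0.
Proof.
by rewrite /enorm big1 ?sqrtr0 // => i _; rewrite mxE expr0n.
Qed.

Lemma continuous_enorm : continuous (@enorm R n).
Proof.
move=> x; apply: (continuous_comp (g := @Num.sqrt R)) (@sqrt_continuous R _).
apply: (@continuous_sum _ _ _ _ (fun i (x : 'rV[R]_n) => x ord0 i ^+ 2)) => i.
by apply: (@continuousM _ _ (fun x : 'rV[R]_n => x ord0 i)); exact: coord_continuous.
Qed.

End enorm_theory.


Definition cube (R : realType) n (M : R) : set 'rV[R]_n := [set x | forall i, `|x ord0 i| <= M].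

Arguments cube R n M : clear implicits.

Section integrable_inverse_square.
Context {R : realType}.

Lemma measurable_cube n M : measurable (cube R n M).
Proof.
rewrite (_ : cube R n M = \bigcap_(i in [set: 'I_n])
   ((fun y : 'rV[R]_n => y ord0 i) @^-1` `[-M, M])).
  apply: fin_bigcap_measurable => //= i _.
  by rewrite -[X in measurable X]setTI; apply: measurable_coord.
apply/seteqP; split => x Hx i.
  by move=> _ /=; rewrite in_itv /= -ler_norml; exact: Hx.
by have /(_ I) := Hx i; rewrite /= in_itv /= -ler_norml.
Qed.

Lemma lebesgue_rV_cube n (M : R) : 0 <= M ->
  lebesgue_rV R n (cube R n M) = ((2 * M) ^+ n)%:E.
Proof.
move=> M0; pose A : set R := [set` `[- M, M]].
have -> : cube R n M = [set x : 'rV[R]_n | forall i, A (x ord0 i)].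
  apply/seteqP; split => x Hx i.
    by rewrite /A /= in_itv /= -ler_norml; exact: Hx.
  by have := Hx i; rewrite /A /= in_itv /= -ler_norml.
apply: (etrans (lebesgue_rV_box (A := fun=> A) _)); first by move=> _; exact: measurable_itv.
rewrite (eq_bigr (fun=> (2 * M)%:E)) => [|i _].
  by rewrite prodEFin prodr_const card_ord.
rewrite /A; have /= -> := @lebesgue_measure_itv R `[- M, M]; rewrite /= lte_fin.
by case: ltP => h; [rewrite -EFinD; congr (_%:E); ring | congr (_%:E); lra].
Qed.

Lemma measurable_inv_sqr_enorm n :
  measurable_fun setT (fun x : 'rV[R]_n => (enorm x ^+ 2)^-1).
Proof.
apply: measurable_continuous_off0 => x x0.
apply: (@continuousV _ _ (fun x : 'rV[R]_n => enorm x ^+ 2)).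
  by rewrite expf_neq0 // gt_eqF // enorm_gt0.
by apply: (@continuousM _ _ (@enorm R n)); exact: continuous_enorm.
Qed.

(** Sorts the points of a cube by their largest coordinate, in
    integrable_inv_sqr; k.+1 is the least exponent whose power of 1/2 lies below
    s. *)
Lemma dyadic_shell (s : R) : 0 < s <= 1 -> exists k, 2^-1 ^+ k.+1 < s <= 2^-1 ^+ k.
Proof.
move=> /andP[s0 s1].
have H : exists m, 2^-1 ^+ m < s.
  have : (fun m => 2^-1 ^+ m : R) @ \oo --> 0.
    by apply: cvg_expr; rewrite ger0_norm ?invr_ge0 // invf_lt1 // ltr1n.
  move=> /cvgrPdist_lt /(_ s s0) [m _ /(_ m (leqnn m))].
  rewrite sub0r normrN ger0_norm ?exprn_ge0 ?invr_ge0 // => Hm; by exists m.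
case: (ex_minnP H) => [[|k]] Hk Hmin; first by move: Hk; rewrite expr0 ltNge s1.
exists k; rewrite Hk /= leNgt; apply/negP => /Hmin; by rewrite ltnn.
Qed.

(** On the dyadic shell between the cubes of half-sides M/2^k.+1 and M/2^k, the
    function is at most a multiple of 4^k, while the measure of the cube is a
    multiple of 2^-(nk). For n >= 3 the resulting series is dominated by a
    geometric one of ratio 1/2. *)
Lemma integrable_inv_sqr n (M : R) : (3 <= n)%N -> 0 < M ->
  (lebesgue_rV R n).-integrable setT
    (fun x => (\1_(cube R n M) x * (enorm x ^+ 2)^-1)%:E).
Proof.
move=> n3 M0.
pose rk k : R := M * 2^-1 ^+ k.
have rk0 k : 0 < rk k by rewrite mulr_gt0 // exprn_gt0 // invr_gt0.
pose c k : R := (rk k.+1 ^+ 2)^-1.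
have c0 k : 0 <= c k by rewrite invr_ge0 sqr_ge0.
pose F k x : \bar R := (c k * \1_(cube R n (rk k)) x)%:E.
have F0 k x : (0 <= F k x)%E by rewrite lee_fin mulr_ge0.
have mF k : measurable_fun setT (F k).
  apply/measurable_EFinP; apply: measurable_funM => //.
  by apply: measurable_indic; exact: measurable_cube.
have mf : measurable_fun setT (fun x : 'rV[R]_n => (\1_(cube R n M) x * (enorm x ^+ 2)^-1)%:E).
  apply/measurable_EFinP; apply: measurable_funM; last exact: measurable_inv_sqr_enorm.
  by apply: measurable_indic; exact: measurable_cube.
apply/integrableP; split => //.
pose C : R := 4 / M ^+ 2 * (2 * M) ^+ n.
have C0 : 0 <= C.
  by rewrite !mulr_ge0 // ?exprn_ge0 ?invr_ge0 ?sqr_ge0 ?mulr_ge0 // ltW.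
apply: (@le_lt_trans _ _ (\int[lebesgue_rV R n]_x (\sum_(0 <= k <oo) F k x))%E).
  apply: ge0_le_integral => //.
  - exact: measurableT_comp.
  - exact: (@ge0_emeasurable_sum _ _ _ setT F xpredT).
  move=> x _; rewrite /= ger0_norm; last by rewrite mulr_ge0 // invr_ge0 sqr_ge0.
  have [->|x0] := eqVneq x 0.
    by rewrite enorm0 expr0n invr0 mulr0; exact: nneseries_ge0.
  rewrite indicE; case: (boolP (x \in cube R n M)) => [|_] /=; last by rewrite mul0r; exact: nneseries_ge0.
  rewrite inE => xM; rewrite mul1r.
  pose s := \big[Order.max/0]_i `|x ord0 i|.
  have sx i : `|x ord0 i| <= s by exact: le_bigmax.
  have s0 : 0 < s.
    rewrite lt_neqAle bigmax_ge_id andbT; apply: contraNneq x0 => e0.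
    by apply/eqP/rowP => i; apply/eqP; rewrite mxE -normr_le0 e0.
  have sM : s <= M by apply: bigmax_le => //; exact: ltW.
  have se : s <= enorm x.
    by apply: bigmax_le => [|i _]; [exact: enorm_ge0 | exact: coord_le_enorm].
  have [|k /andP[k1 k2]] := @dyadic_shell (s / M).
    by rewrite divr_gt0 // ler_pdivrMr // mul1r sM.
  move: k1 k2; rewrite ltr_pdivlMr // ler_pdivrMr // => k1 k2.
  apply: (@le_trans _ _ (F k x)); last first.
    by rewrite [leRHS](@nneseries_split _ _ _ k.+1) // big_nat_recr //= ?add0n
      -addeA addeC -addeA leeDl // adde_ge0 // ?nneseries_ge0 // sume_ge0.
  rewrite lee_fin indicE mem_set ?mulr1; last first.
    by move=> i; rewrite (le_trans (sx i)) // /rk mulrC.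
  rewrite lef_pV2 ?posrE ?exprn_gt0 ?enorm_gt0 //.
  by rewrite ler_pXn2r ?nnegrE ?enorm_ge0 ?ltW // (lt_le_trans _ se) // /rk mulrC.
rewrite integral_nneseries //.
apply: (@le_lt_trans _ _ (2 * C)%:E); last exact: ltry.
have sum_half m : \sum_(0 <= k < m) 2^-1 ^+ k = 2 - 2 * 2^-1 ^+ m :> R.
  elim: m => [|m IH]; first by rewrite big_geq // expr0; ring.
  by rewrite big_nat_recr //= IH exprS; field.
apply: lime_le; first by apply: is_cvg_nneseries => *; exact: integral_ge0.
near=> m.
have E k : (\int[lebesgue_rV R n]_x F k x <= (C * 2^-1 ^+ k)%:E)%E.
  rewrite /F; under eq_integral do rewrite EFinM.
  rewrite ge0_integralZl //; last 2 first.
    by apply/measurable_EFinP/measurable_indic; exact: measurable_cube.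
    by rewrite lee_fin.
  rewrite integral_indic //; last exact: measurable_cube.
  rewrite setIT [X in (_ * X)%E](lebesgue_rV_cube n (ltW (rk0 k))) -EFinM lee_fin.
  pose q : R := 2^-1 ^+ k; have q0 : 0 < q by rewrite exprn_gt0 // invr_gt0.
  have q1 : q <= 1 by rewrite exprn_ile1 ?invr_ge0 // invf_le1 // ler1n.
  (* three of the n factors q absorb the singularity q^-2 and leave one q for
     the geometric series *)
  have -> : c k * (2 * rk k) ^+ n = C * q * q ^+ (n - 3).
    rewrite /c /rk /C [2^-1 ^+ k.+1]exprS -/q [2 * (M * q)]mulrA [(_ * q) ^+ n]exprMn (_ : q ^+ n = q ^+ (n - 3) * q ^+ 3); last by rewrite -exprD subnK.
    by field; rewrite !gt_eqF.
  by apply: ler_piMr; [rewrite mulr_ge0 // ltW | rewrite exprn_ile1 // ltW].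
apply: (@le_trans _ _ (\sum_(0 <= k < m) (C * 2^-1 ^+ k)%:E)%E).
  by apply: lee_sum => k _.
rewrite sumEFin lee_fin -mulr_sumr mulrC ler_wpM2r //.
by rewrite sum_half gerBl mulr_ge0 // exprn_ge0 ?invr_ge0.
Unshelve. all: by end_near. Qed.

End integrable_inverse_square.

(** * Symmetry of second derivatives *)

Section mixed_partials.
Context {R : realType}.

Lemma is_derive_line (V : normedModType R) (f : V -> R) (x v : V) (s l : R) :
  is_derive (s *: v + x) v f l ->
  is_derive s (1 : R) (fun t => f (t *: v + x)) l.
Proof.
move=> dl; apply: (@is_derive_affine _ _ _ (fun t : R => t *: v + x) f s 1 v) => // h.
by rewrite addrA -scalerDl /GRing.scale /= mulr1.
Qed.

(** The mean value theorem, applied first in direction v and then in direction w. *)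
Lemma second_difference (V : normedModType R) (f : V -> R) (v w x : V) (e : R) :
  0 < e -> (forall y, derivable f y v) ->
  (forall y, derivable (fun z => 'D_v f z) y w) ->
  exists s t : R, [/\ 0 < s < e, 0 < t < e &
    f (e *: v + (e *: w + x)) - f (e *: v + x) - f (e *: w + x) + f x =
    e * e * 'D_w (fun z => 'D_v f z) (t *: w + (s *: v + x))].
Proof.
move=> e0 df ddf.
pose phi s := f (s *: v + (e *: w + x)) - f (s *: v + x).
pose dphi s := 'D_v f (s *: v + (e *: w + x)) - 'D_v f (s *: v + x).
have dphiE s : is_derive s (1 : R) phi (dphi s).
  by apply: is_deriveB; apply: is_derive_line; exact/derivableP.
have [s] := @MVT R phi dphi 0 e e0 (fun s _ => dphiE s) (derivable_within_continuous (fun s _ => @ex_derive _ _ _ _ _ _ _ (dphiE s))).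
rewrite in_itv /= => s0e; rewrite subr0 => Es.
pose psi t := 'D_v f (t *: w + (s *: v + x)).
pose dpsi t := 'D_w (fun z => 'D_v f z) (t *: w + (s *: v + x)).
have dpsiE t : is_derive t (1 : R) psi (dpsi t).
  by apply: (@is_derive_line _ (fun z => 'D_v f z)); exact/derivableP.
have [t] := @MVT R psi dpsi 0 e e0 (fun s _ => dpsiE s) (derivable_within_continuous (fun s _ => @ex_derive _ _ _ _ _ _ _ (dpsiE s))).
rewrite in_itv /= => t0e; rewrite subr0 => Et.
exists s, t; split => //.
transitivity (phi e - phi 0).
  by rewrite /phi !scale0r !add0r; ring.
rewrite Es [LHS]mulrC -mulrA; congr (_ * _).
rewrite -/(dpsi t) [RHS]mulrC -Et /psi /dphi scale0r add0r.
by congr ('D_v f _ - _); rewrite addrCA.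
Qed.

(** Schwarz: the second difference is symmetric in v and w, so by
    second_difference the two mixed derivatives agree at points arbitrarily
    close to x; continuity does the rest. *)
Lemma derive_comm n (f : 'rV[R]_n -> R) (i j : 'I_n) (x : 'rV[R]_n)
    (v := delta_mx ord0 i : 'rV[R]_n) (w := delta_mx ord0 j : 'rV[R]_n) :
  (forall y, derivable f y v) -> (forall y, derivable f y w) ->
  (forall y, derivable (fun z => 'D_v f z) y w) ->
  (forall y, derivable (fun z => 'D_w f z) y v) ->
  continuous (fun y => 'D_w (fun z => 'D_v f z) y) ->
  continuous (fun y => 'D_v (fun z => 'D_w f z) y) ->
  'D_w (fun z => 'D_v f z) x = 'D_v (fun z => 'D_w f z) x.
Proof.
move=> dv dw dvw dwv cvw cwv.
apply/eqP; rewrite -subr_eq0 -normr_le0; apply/ler_addgt0Pr => e e0; rewrite add0r.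
have close (p q z z' : R) :
    z = z' -> `|p - z| < e / 2 -> `|q - z'| < e / 2 -> `|p - q| <= e.
  move=> <- pz; rewrite distrC => zq.
  by rewrite (le_trans (ler_distD z _ _)) // [leRHS]splitr lerD // ltW.
have e20 : 0 < e / 2 by rewrite divr_gt0.
have /cvgrPdist_lt/(_ _ e20)/near_rV_coord[a a0 Ha] := cvw x.
have /cvgrPdist_lt/(_ _ e20)/near_rV_coord[b b0 Hb] := cwv x.
pose d := Num.min a b / 2.
have m0 : 0 < Num.min a b by rewrite lt_min a0.
have d0 : 0 < d by rewrite divr_gt0.
have near_x (s t : R) (k l : 'I_n) : 0 < s < d -> 0 < t < d -> forall i,
    `|x ord0 i - (s *: delta_mx ord0 k + (t *: delta_mx ord0 l + x) : 'rV[R]_n) ord0 i| < Num.min a b.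
  move=> /andP[s0 sd] /andP[t0 td] h; rewrite !mxE /=.
  rewrite (_ : _ - _ = - (s * (h == k)%:R + t * (h == l)%:R)); last by ring.
  rewrite normrN (le_lt_trans (ler_normD _ _)) // !normrM !normr_nat (gtr0_norm s0) (gtr0_norm t0).
  rewrite (le_lt_trans (y := s + t)) //.
    by rewrite lerD //; apply: ler_piMr; rewrite ?lern1 ?leq_b1 // ltW.
  by rewrite [ltRHS](splitr) ltrD.
have [s [t [s0 t0 E1]]] := second_difference x d0 dv dvw.
have [s' [t' [s0' t0' E2]]] := second_difference x d0 dw dwv.
have E : d * d * 'D_w (fun z => 'D_v f z) (t *: w + (s *: v + x)) =
         d * d * 'D_v (fun z => 'D_w f z) (t' *: v + (s' *: w + x)).
  apply: (etrans (esym E1)); apply: (etrans _ E2); rewrite (addrCA (d *: v)).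
  by rewrite -!addrA; congr (_ + _); rewrite addrCA.
have {}E := mulfI (mulf_neq0 (lt0r_neq0 d0) (lt0r_neq0 d0)) E.
have ma : Num.min a b <= a by rewrite ge_min lexx.
have mb : Num.min a b <= b by rewrite ge_min lexx orbT.
have H1 := Ha (t *: w + (s *: v + x)) (fun h => lt_le_trans (near_x _ _ j i t0 s0 h) ma).
have H2 := Hb (t' *: v + (s' *: w + x)) (fun h => lt_le_trans (near_x _ _ i j t0' s0' h) mb).
exact: close E H1 H2.
Qed.

End mixed_partials.

(** * Pointwise inequalities *)

Section pointwise.
Context {R : realType} (n : nat).
Implicit Types (t V Y g : 'I_n -> R).

(** Cauchy-Schwarz against a unit vector, from the square of the component of V
    orthogonal to t. *)
Lemma unit_dot_sqr_le t V : \sum_i t i ^+ 2 = 1 ->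
  (\sum_i t i * V i) ^+ 2 <= \sum_i V i ^+ 2.
Proof.
move=> t1; set c := \sum_i t i * V i.
have : 0 <= \sum_i (V i - c * t i) ^+ 2 by apply: sumr_ge0 => i _; exact: sqr_ge0.
rewrite (eq_bigr (fun i => V i ^+ 2 + (- (2 * c)) * (t i * V i) + c ^+ 2 * t i ^+ 2)); last first.
  by move=> i _; ring.
rewrite !big_split /= -!mulr_sumr t1 -/c => H.
by rewrite -subr_ge0 (_ : _ - _ = \sum_i V i ^+ 2 + - (2 * c) * c + c ^+ 2 * 1) //; ring.
Qed.

(** Split H into its t-t entry a, its mixed part, of squared norm |Y|^2 - a^2
    counted twice, and its restriction to the orthogonal complement of t, which
    has trace tau - a and dimension n - 1. The trace inequality on this
    complement is the Lichnerowicz argument for the first eigenvalue of the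
    sphere. *)
Lemma hessian_sqr_ge t (H : 'I_n -> 'I_n -> R) (n2 : (2 <= n)%N)
    (Y := fun i => \sum_j t j * H i j) (a := \sum_i t i * Y i)
    (tau := \sum_i H i i) :
  \sum_i t i ^+ 2 = 1 -> (forall i j, H i j = H j i) ->
  (tau - a) ^+ 2 + (n%:R - 1) * (2 * \sum_i Y i ^+ 2 - a ^+ 2) <=
  (n%:R - 1) * \sum_i \sum_j H i j ^+ 2.
Proof.
move=> t1 Hs; have n1 : 0 < n%:R - 1 :> R by rewrite subr_gt0 ltr1n.
(* A is the block of H orthogonal to t plus l times the projection to t, so that
   A - l Id is the trace-free part of this block; its squared norm is the
   deficit *)
pose l := (tau - a) / (n%:R - 1); pose s := a + l.
set Y2 := \sum_i Y i ^+ 2.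
pose A i j := H i j - t i * Y j - Y i * t j + s * (t i * t j).
have diag : \sum_i \sum_j (A i j - l * (i == j)%:R) ^+ 2 =
    \sum_i \sum_j A i j ^+ 2 - 2 * l * \sum_i A i i + n%:R * l ^+ 2.
  have -> : n%:R * l ^+ 2 = \sum_(i < n) l ^+ 2.
    by rewrite sumr_const card_ord mulr_natl.
  rewrite mulr_sumr -sumrB -big_split /=; apply: eq_bigr => i _.
  rewrite (bigD1 i) //= [in RHS](bigD1 i) //= eqxx.
  rewrite (eq_bigr (fun j => A i j ^+ 2)); first by rewrite mulr1; ring.
  by move=> j ji; rewrite eq_sym (negbTE ji) mulr0 subr0.
have YH : \sum_i t i * (\sum_j H i j * Y j) = Y2.
  under eq_bigr do rewrite mulr_sumr.
  rewrite exchange_big /=; apply: eq_bigr => j _.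
  rewrite expr2 {2}/Y mulr_suml; apply: eq_bigr => i _.
  by rewrite Hs; ring.
have row i : \sum_j A i j ^+ 2 = \sum_j H i j ^+ 2 + t i ^+ 2 * (Y2 + s ^+ 2 - 2 * s * a)
    + (-1) * Y i ^+ 2 + (- 2) * (t i * \sum_j H i j * Y j) + 2 * a * (t i * Y i).
  rewrite (eq_bigr (fun j => H i j ^+ 2 + t i ^+ 2 * Y j ^+ 2 + (Y i ^+ 2 + s ^+ 2 * t i ^+ 2 - 2 * s * (t i * Y i)) * t j ^+ 2
     + (- 2 * t i) * (H i j * Y j) + (- 2 * Y i + 2 * s * t i) * (t j * H i j)
     + (2 * t i * Y i - 2 * s * t i ^+ 2) * (t j * Y j))); last first.
    by move=> j _; rewrite /A; ring.
  rewrite !big_split /= -!mulr_sumr t1 -/(Y i) -/a -/Y2; ring.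
have tot : \sum_i \sum_j A i j ^+ 2 =
    \sum_i \sum_j H i j ^+ 2 - 2 * Y2 + s ^+ 2 - 2 * s * a + 2 * a ^+ 2.
  rewrite (eq_bigr _ (fun i _ => row i)) !big_split /= -!mulr_sumr -mulr_suml t1 YH -/a -/Y2.
  ring.
have tr : \sum_i A i i = tau - 2 * a + s.
  rewrite (eq_bigr (fun i => H i i + (-2) * (t i * Y i) + s * t i ^+ 2)); last first.
    by move=> i _; rewrite /A; ring.
  by rewrite !big_split /= -!mulr_sumr t1 -/a -/tau; ring.
have : 0 <= \sum_i \sum_j (A i j - l * (i == j)%:R) ^+ 2.
  by apply: sumr_ge0 => i _; apply: sumr_ge0 => j _; exact: sqr_ge0.
rewrite diag tot tr => /(mulr_ge0 (ltW n1)) G; rewrite -subr_ge0.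
suff <- : (n%:R - 1) * (\sum_i \sum_j H i j ^+ 2 - 2 * Y2 + s ^+ 2 - 2 * s * a +
  2 * a ^+ 2 - 2 * l * (tau - 2 * a + s) + n%:R * l ^+ 2) =
  (n%:R - 1) * (\sum_i \sum_j H i j ^+ 2) -
  ((tau - a) ^+ 2 + (n%:R - 1) * (2 * Y2 - a ^+ 2)) by exact: G.
by rewrite /s /l; field; rewrite gt_eqF.
Qed.

End pointwise.

Section certificate.
Context {R : realType}.

(** Here tau = Delta u, H2 = |Hess u|^2, and with theta = x/|x|: Y = |Hess u theta|^2,
    a = theta . Hess u theta, G = |grad u|^2 / |x|^2, P = theta . grad u / |x|,
    Z = grad u . Hess u theta / |x|; w stands for the rescaled weight
    m |x|^(1-b). The six terms on the left are those that integrate to zero.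

    The difference of the two sides is a sum of five nonnegative terms: the deficits
    of the trace inequality Hess and of Cauchy-Schwarz CS, the square of
    a + c P + w P, and two multiples of G - P^2, the squared norm of the tangential
    part of grad u / |x|. The radial square alone has the sharp constant.
    The parameters al and be are chosen for the tangential part: al^2 = 2 is the
    amount of tangential derivatives left by the Hessian, be makes the coefficient
    of w G sharp up to w (1 - b) (al - 1), and what remains is
    (n^2 - 4 n - 4) / 4, which is nonnegative from n = 5 on. *)
Lemma pointwise_certificate (n b K w al be c : R)
    (tau H2 Y a Z G P : R) :
  5 <= n -> al ^+ 2 = 2 -> 1 <= al -> K ^+ 2 = n ^+ 2 ->
  be = (al * (n - 4) + K) / 2 -> c = (K + n - 2) / 2 -> 0 <= w * (1 - b) ->
  (tau - a) ^+ 2 + (n - 1) * (2 * Y - a ^+ 2) <= (n - 1) * H2 ->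
  (al * (a + P) + (be + w) * P) ^+ 2 <=
    al ^+ 2 * (Y + 2 * Z + G) + 2 * al * (be + w) * (Z + G) + (be + w) ^+ 2 * G ->
  P ^+ 2 <= G ->
  (n - 1) / (n - 2) * (tau ^+ 2 - H2)
  + - (2 / (n - 2)) * (a * tau - (n - 3) * Z - Y - 2 * (a * P))
  + - ((n - 3) / (n - 2) + 2 + al * be) * ((n - 2) * G + 2 * Z)
  + - (2 / (n - 2) + c - 2 - al * be) * ((n - 2) * P ^+ 2 + 2 * (P * a))
  + - al * (w * ((n - b - 1) * G + 2 * Z))
  + (al - 1) * (w * ((n - b - 1) * P ^+ 2 + 2 * (P * a)))
  <= tau ^+ 2 + w ^+ 2 * G + (K + b - 1) * w * G.
Proof.
move=> n5 al2 al1 K2 beE cE wb Hess CS PG.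
have n2 : 0 < n - 2 by lra.
have h1 : 0 <= ((n - 1) * H2 - ((tau - a) ^+ 2 + (n - 1) * (2 * Y - a ^+ 2))) / (n - 2).
  by apply: divr_ge0; [rewrite subr_ge0 | exact: ltW].
have h2 := CS; rewrite -subr_ge0 in h2.
have h3 : 0 <= (a + c * P + w * P) ^+ 2 by exact: sqr_ge0.
have h4 : 0 <= (n ^+ 2 - 4 * n - 4) / 4 * (G - P ^+ 2).
  apply: mulr_ge0; rewrite ?subr_ge0 // divr_ge0 //.
  have : 0 <= (n - 5) * (n + 1) by rewrite mulr_ge0 //; lra.
  by move=> h; lra.
have h5 : 0 <= w * (1 - b) * (al - 1) * (G - P ^+ 2).
  by apply: mulr_ge0; rewrite ?subr_ge0 // mulr_ge0 // subr_ge0.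
rewrite -subr_ge0; have := addr_ge0 (addr_ge0 (addr_ge0 h1 h2) h3) (addr_ge0 h4 h5).
move=> H; match type of H with is_true (_ <= ?x) =>
  match goal with |- is_true (_ <= ?y) => suff <- : x = y by exact: H end end.
apply/eqP; rewrite -subr_eq0; apply/eqP.
transitivity ((2 - al ^+ 2) * ((n - 4) / 2 * ((n - 2) * (G - P ^+ 2) + 2 * Z - 2 * P * a)
  - (Y + 2 * Z + G) + (a + P) ^+ 2 - (n - 4) * (Z + G) + (n - 4) * (a + P) * P
  - (n - 4) ^+ 2 / 4 * (G - P ^+ 2))); last by rewrite al2 subrr mul0r.
(* the two cases are the regimes b > 1 and b < 1 *)
have /orP[/eqP KE|/eqP KE] : (K == n) || (K == - n) by rewrite -eqf_sqr K2.
  by rewrite beE cE KE; field; rewrite gt_eqF.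
by rewrite beE cE KE; field; rewrite gt_eqF.
Qed.

End certificate.

(** * Calculus away from the origin *)

Section punctured_calculus.
Context {R : realType} (n : nat).
Notation rV := 'rV[R]_n.
Notation "''e_' i" := (delta_mx ord0 i : rV) (at level 8, i at level 2, format "''e_' i").
Implicit Types (f g W : rV -> R) (x : rV).

Definition cont_off0 f := forall x, x != 0 -> {for x, continuous f}.

Lemma cont_off0D f g : cont_off0 f -> cont_off0 g -> cont_off0 (fun x => f x + g x).
Proof. by move=> cf cg x x0; exact: cvgD (cf x x0) (cg x x0). Qed.

Lemma cont_off0M f g : cont_off0 f -> cont_off0 g -> cont_off0 (fun x => f x * g x).
Proof. by move=> cf cg x x0; exact: cvgM (cf x x0) (cg x x0). Qed.

Lemma cont_off0_cst (c : R) : cont_off0 (fun=> c).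
Proof. by move=> x _; exact: cst_continuous. Qed.

Lemma cont_off0_sum (I : finType) (F : I -> rV -> R) :
  (forall i, cont_off0 (F i)) -> cont_off0 (fun x => \sum_i F i x).
Proof. by move=> cF x x0; apply: continuous_sum => i; exact: cF. Qed.

Lemma cont_off0_coord i : cont_off0 (fun x => x ord0 i).
Proof. by move=> x _; exact: coord_continuous. Qed.

Lemma cont_off0_continuous f : continuous f -> cont_off0 f.
Proof. by move=> cf x _; exact: cf. Qed.

Lemma cont_off0_inv_enorm : cont_off0 (fun x => (enorm x)^-1).
Proof.
move=> x x0; apply: (@continuousV _ _ (@enorm R n)); first by rewrite gt_eqF // enorm_gt0.
exact: continuous_enorm.
Qed.

Lemma is_derive_coord x i j :
  is_derive x 'e_i (fun y : rV => y ord0 j) (i == j)%:R.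
Proof.
have E : (fun h : R => h^-1 *: (((fun y : rV => y ord0 j) \o shift x) (h *: 'e_i) - x ord0 j)) @ 0^'
   --> ((i == j)%:R : R).
  apply: cvg_near_cst; near=> h.
  rewrite /= !mxE eqxx /= addrK /GRing.scale /= mulrA mulVf ?mul1r 1?eq_sym // eq_sym.
  by near: h; exists 1 => //= z _ /=; rewrite eq_sym.
by split; [exact: cvgP E | exact: cvg_lim E].
Unshelve. all: by end_near. Qed.

(** Variant of is_deriveM for pointwise products written with a lambda, and with
    the derivative left to be matched. *)
Lemma is_derive_mul x (v : rV) f g (df dg l : R) :
  is_derive x v f df -> is_derive x v g dg -> l = f x * dg + g x * df ->
  is_derive x v (fun y => f y * g y) l.
Proof. by move=> Hf Hg ->; exact: (is_deriveM Hf Hg). Qed.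

Lemma is_derive_bigsum m x (v : rV) (F : 'I_m -> rV -> R) (dF : 'I_m -> R) (l : R) :
  (forall j, is_derive x v (F j) (dF j)) -> l = \sum_j dF j ->
  is_derive x v (fun y => \sum_j F j y) l.
Proof.
move=> HF ->; rewrite (_ : (fun y => _) = \sum_j F j); first exact: is_derive_sum.
by apply/funext => y; rewrite fct_sumE.
Qed.

(** The chain rule along a line, the outer function being a function of one real
    variable. *)
Lemma is_derive_comp1 x (v : rV) f (phi : R -> R) (l l' : R) :
  is_derive x v f l -> is_derive (f x) (1 : R) phi l' ->
  is_derive x v (phi \o f) (l' * l).
Proof.
move=> df dphi.
pose F t := f (t *: v + x).
have F0 : F 0 = f x by rewrite /F scale0r add0r.
have dF : is_derive (0 : R) (1 : R) F l by apply: is_derive_line; rewrite scale0r add0r.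
have dphi' : is_derive (F 0) (1 : R) phi l' by rewrite F0.
have dc : is_derive (0 : R) (1 : R) (phi \o F) (l' * l).
  split.
    apply/derivable1_diffP/differentiable_comp; apply/derivable1_diffP;
      [exact: (@ex_derive _ _ _ _ _ _ _ dF) | exact: (@ex_derive _ _ _ _ _ _ _ dphi')].
  rewrite -derive1E derive1_comp ?derive1E; first by case: dF dphi' => _ -> [_ ->].
    exact: (@ex_derive _ _ _ _ _ _ _ dF).
  exact: (@ex_derive _ _ _ _ _ _ _ dphi').
have E : (fun h : R => h^-1 *: (((phi \o F) \o shift 0) (h *: (1 : R)) - (phi \o F) 0)) =
         (fun h : R => h^-1 *: (((phi \o f) \o shift x) (h *: v) - (phi \o f) x)).
  by apply/funext => h; rewrite /= F0 /F addr0 [_%:A]mulr1.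
case: dc => d1 d2; split; first by move: d1; rewrite /derivable E.
by move: d2; rewrite /derive E.
Qed.

(** The gradient of a radial function that is homogeneous of degree s is s W(x)
    x / |x|^2; only this is used of a weight, and it is stable under products.
    *)
Definition homogeneous (s : R) W := cont_off0 W /\ forall x i, x != 0 ->
  is_derive x 'e_i W (s * W x * x ord0 i * (enorm x)^-1 ^+ 2).

Lemma homogeneousM s s' W W' : homogeneous s W -> homogeneous s' W' ->
  homogeneous (s + s') (fun x => W x * W' x).
Proof.
move=> [cW dW] [cW' dW']; split; first exact: cont_off0M.
move=> x i x0; apply: is_derive_eq; first exact: is_deriveM (dW x i x0) (dW' x i x0).
by rewrite /GRing.scale /=; ring.
Qed.

Lemma is_derive_powR (t s : R) : 0 < t ->
  is_derive t (1 : R) (fun z => z `^ s) (s * t `^ (s - 1)).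
Proof.
move=> t0; have ti : t \in `]0, +oo[ by rewrite in_itv /= andbT.
split; first exact: derivable_powR.
by rewrite -derive1E powR_derive1.
Qed.

Lemma powR_enormE s x : enorm x `^ s = (\sum_i x ord0 i ^+ 2) `^ (s / 2).
Proof.
rewrite -sqr_enorm -powR_mulrn ?enorm_ge0 // -powRrM; congr (_ `^ _).
by field.
Qed.

Lemma homogeneous_powR_enorm s : homogeneous s (fun x => enorm x `^ s).
Proof.
have dW x i : x != 0 -> is_derive x 'e_i (fun x => enorm x `^ s)
   (s * enorm x `^ s * x ord0 i * (enorm x)^-1 ^+ 2).
  move=> x0; have r0 := enorm_gt0 x0.
  rewrite (_ : (fun x => _) = (fun z => z `^ (s / 2)) \o (fun x : rV => \sum_i x ord0 i ^+ 2)); last first.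
    by apply/funext => y; rewrite powR_enormE.
  have d2 : is_derive x 'e_i (fun x : rV => \sum_i x ord0 i ^+ 2) (2 * x ord0 i).
    rewrite (_ : (fun x => _) = \sum_j (fun x : rV => x ord0 j * x ord0 j)); last first.
      by apply/funext => y; rewrite fct_sumE; apply: eq_bigr => j _; rewrite expr2.
    apply: is_derive_eq.
      apply: is_derive_sum => j; exact: is_deriveM (is_derive_coord x i j) (is_derive_coord x i j).
    rewrite (bigD1 i) //= big1 ?addr0 ?eqxx; first by rewrite /GRing.scale /= mulr1 mulr_natl mulr2n.
    by move=> j ji; rewrite eq_sym (negbTE ji) !scaler0 addr0.
  apply: is_derive_eq.
    apply: is_derive_comp1 d2 _; apply: is_derive_powR.
    by rewrite -sqr_enorm exprn_gt0.
  rewrite powR_enormE powRB; last by rewrite -sqr_enorm (gt_eqF (exprn_gt0 2 r0)); apply: implybT.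
  rewrite powRr1 -?sqr_enorm ?sqr_ge0 //.
  by field; rewrite gt_eqF.
split => // x x0.
have : {for x, continuous ((@powR R)^~ s \o @enorm R n)}.
  apply: continuous_comp; first exact: continuous_enorm.
  have [dp _] := is_derive_powR s (enorm_gt0 x0).
  by apply/differentiable_continuous/derivable1_diffP.
by [].
Qed.

Lemma homogeneous_inv_enorm : homogeneous (-1) (fun x => (enorm x)^-1).
Proof.
rewrite (_ : (fun x => _) = (fun x => enorm x `^ (-1))).
  exact: homogeneous_powR_enorm.
by apply/funext => x; rewrite powR_inv1 // enorm_ge0.
Qed.

End punctured_calculus.

(** * Integrals over the punctured space *)

Section punctured_integrals.
Context {R : realType} (n : nat) (n2 : (2 <= n)%N).
Notation rV := 'rV[R]_n.
Notation "''e_' i" := (delta_mx ord0 i : rV) (at level 8, i at level 2, format "''e_' i").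
Notation mu := (lebesgue_rV R n).
Notation D := [set~ (0 : rV)].
Implicit Types (f g W : rV -> R) (x : rV).

Let mD : measurable D.
Proof. by apply: measurableC; exact: measurable_rV0. Qed.

(** All integrals are taken over the punctured space, so that pointwise
    hypotheses are needed only where the singular weights are differentiable. *)
Definition int0 f := mu.-integrable D (EFin \o f).

Lemma int0_ext f g : (forall x, x != 0 -> f x = g x) -> int0 f -> int0 g.
Proof.
by move=> fg; apply: eq_integrable => // x; rewrite inE => /eqP x0; rewrite /= fg.
Qed.

Lemma int0D f g : int0 f -> int0 g -> int0 (fun x => f x + g x).
Proof. by move=> If Ig; have := integrableD mD If Ig; apply: eq_integrable. Qed.

Lemma int0Z (c : R) f : int0 f -> int0 (fun x => c * f x).
Proof. by move=> If; have := integrableZl mD c If; apply: eq_integrable. Qed.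

Lemma int0_sum (I : finType) (F : I -> rV -> R) :
  (forall i, int0 (F i)) -> int0 (fun x => \sum_i F i x).
Proof.
move=> IF; have := integrable_sum mD (index_enum I) (P := predT) (fun i _ => IF i).
by apply: eq_integrable => // x _; rewrite /= sumEFin.
Qed.

Lemma int0_le f g : cont_off0 f -> int0 g ->
  (forall x, x != 0 -> `|f x| <= g x) -> int0 f.
Proof.
move=> cf Ig fg; apply: le_integrable Ig => //.
  by apply/measurable_EFinP/measurable_funTS; exact: measurable_continuous_off0.
move=> x /eqP x0; rewrite /= lee_fin; apply: le_trans (fg x x0) (ler_norm _).
Qed.

(** Being null is stable under linear combinations: this is how divergences are
    discarded. *)
Definition null f := int0 f /\ (\int[mu]_(x in D) (f x)%:E = 0)%E.

Lemma null_ext f g : (forall x, x != 0 -> f x = g x) -> null f -> null g.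
Proof.
move=> fg [If f0]; split; first exact: int0_ext If.
by rewrite -f0; apply: eq_integral => x; rewrite inE => /eqP x0; rewrite fg.
Qed.

Lemma nullD f g : null f -> null g -> null (fun x => f x + g x).
Proof.
move=> [If f0] [Ig g0]; split; first exact: int0D.
under eq_integral do rewrite EFinD.
by rewrite integralD // f0 g0 adde0.
Qed.

Lemma nullZ (c : R) f : null f -> null (fun x => c * f x).
Proof.
move=> [If f0]; split; first exact: int0Z.
by under eq_integral do rewrite EFinM; rewrite integralZl // f0 mule0.
Qed.

Lemma null_cst0 : null (fun=> 0).
Proof.
split; last by rewrite integral0.
by have := @integrable0 _ _ _ mu D; apply: eq_integrable.
Qed.

Lemma null_sum (I : finType) (F : I -> rV -> R) :
  (forall i, null (F i)) -> null (fun x => \sum_i F i x).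
Proof.
move=> nF; elim: (index_enum I) => [|i r IH].
  by apply: null_ext null_cst0 => x _; rewrite big_nil.
by apply: null_ext (nullD (nF i) IH) => x _; rewrite big_cons.
Qed.

Definition supp M f := forall x k, M < `|x ord0 k| -> f x = 0.

Lemma null_partial M (i : 'I_n) f df :
  (forall x, x != 0 -> is_derive x 'e_i f (df x)) -> cont_off0 df ->
  supp M f -> int0 df -> null df.
Proof.
move=> dF cdf sf Idf; split => //.
have mdf : measurable_fun setT (EFin \o df).
  by apply/measurable_EFinP; exact: measurable_continuous_off0.
have mu0 : mu [set (0 : rV)] = 0%E by apply: lebesgue_rV0; exact: ltnW.
have Dd : D = setT `\` [set (0 : rV)] by rewrite setTD.
have IT : mu.-integrable setT (EFin \o df).
  apply/(negligible_integrable (@measurable_rV0 R n) measurableT mdf mu0).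
  by rewrite -Dd.
rewrite Dd -(negligible_integral (@measurable_rV0 R n) measurableT IT mu0).
apply: (@integral_partial_eq0 _ _ i f df M) => // x Hx.
suff x0 : x != 0 by split; [exact: dF | exact: cdf].
(* since n >= 2, a point with a nonzero coordinate other than the i-th is not
   the origin *)
have [k ki] : exists k : 'I_n, k != i.
  pose a : 'I_n := Ordinal (ltnW n2); pose b : 'I_n := Ordinal n2.
  by case: (eqVneq i a) => [->|ia]; [exists b | exists a; rewrite eq_sym].
by apply: contraNneq (Hx k ki) => ->; rewrite mxE.
Qed.

(** Every integrability condition below is reduced to products of two functions
    of this class, which contains the second derivatives of u and the weighted
    first derivatives. *)
Definition L2 f := cont_off0 f /\ int0 (fun x => f x ^+ 2).

Lemma L2_ext f g : (forall x, x != 0 -> f x = g x) -> cont_off0 g -> L2 f -> L2 g.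
Proof. by move=> fg cg [_ If]; split => //; apply: int0_ext If => x /fg ->. Qed.

Lemma L2M f g : L2 f -> L2 g -> int0 (fun x => f x * g x).
Proof.
move=> [cf If] [cg Ig]; apply: (int0_le _ (int0D If Ig)); first exact: cont_off0M.
move=> x _; rewrite ler_norml -subr_ge0.
have h1 : 0 <= (f x + g x) ^+ 2 by exact: sqr_ge0.
have h2 : 0 <= (f x - g x) ^+ 2 by exact: sqr_ge0.
have h3 := sqr_ge0 (f x); have h4 := sqr_ge0 (g x).
apply/andP; split; nra.
Qed.

Lemma L2D f g : L2 f -> L2 g -> L2 (fun x => f x + g x).
Proof.
move=> Lf Lg; have Ifg := L2M Lf Lg; case: Lf Lg => cf If [cg Ig].
split; first exact: cont_off0D.
apply: int0_ext (int0D (int0D If Ig) (int0Z 2 Ifg)) => x _; ring.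
Qed.

Lemma L2_bounded (C : R) W f : cont_off0 W -> (forall x, x != 0 -> `|W x| <= C) ->
  L2 f -> L2 (fun x => W x * f x).
Proof.
move=> cW WC [cf If]; split; first exact: cont_off0M.
have cWf := cont_off0M cW cf.
apply: (int0_le (cont_off0M cWf cWf) (int0Z (C ^+ 2) If)) => x x0.
rewrite -expr2 ger0_norm ?sqr_ge0 // exprMn ler_wpM2r ?sqr_ge0 //.
by rewrite -(real_normK (num_real (W x))) lerXn2r ?nnegrE // ?(le_trans _ (WC x x0)) // WC.
Qed.

Lemma L2Z (c : R) f : L2 f -> L2 (fun x => c * f x).
Proof. by apply: (@L2_bounded `|c|) => //; exact: cont_off0_cst. Qed.

Lemma L2_cst0 : L2 (fun=> 0).
Proof.
split; first exact: cont_off0_cst.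
by apply: int0_ext (null_cst0.1) => x _; rewrite expr0n.
Qed.

Lemma L2_sum (I : finType) (F : I -> rV -> R) :
  (forall i, L2 (F i)) -> L2 (fun x => \sum_i F i x).
Proof.
move=> LF; elim: (index_enum I) => [|i r IH].
  rewrite (_ : (fun x => _) = (fun=> 0)); first exact: L2_cst0.
  by apply/funext => x; rewrite big_nil.
rewrite (_ : (fun x => _) = (fun x => F i x + \sum_(j <- r) F j x)); first exact: L2D.
by apply/funext => x; rewrite big_cons.
Qed.

Definition dircos (i : 'I_n) x := x ord0 i * (enorm x)^-1.

Lemma cont_dircos i : cont_off0 (dircos i).
Proof. by apply: cont_off0M; [exact: cont_off0_coord | exact: cont_off0_inv_enorm]. Qed.

Lemma dircos_le1 i x : x != 0 -> `|dircos i x| <= 1.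
Proof.
move=> x0; have r0 := enorm_gt0 x0.
rewrite normrM normfV (gtr0_norm r0) ler_pdivrMr // mul1r; exact: coord_le_enorm.
Qed.

Lemma sum_sqr_dircos x : x != 0 -> \sum_i dircos i x ^+ 2 = 1.
Proof.
move=> x0; have r0 := enorm_gt0 x0.
under eq_bigr do rewrite exprMn.
by rewrite -mulr_suml -sqr_enorm -exprMn divff ?gt_eqF // expr1n.
Qed.

Lemma L2_dircos i f : L2 f -> L2 (fun x => dircos i x * f x).
Proof. by apply: (@L2_bounded 1); [exact: cont_dircos | move=> x; exact: dircos_le1]. Qed.

Lemma int0_bounded (C : R) W f : cont_off0 W -> (forall x, x != 0 -> `|W x| <= C) ->
  cont_off0 f -> int0 f -> int0 (fun x => W x * f x).
Proof.
move=> cW WC cf If; have /integrable_norm Inf := If.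
apply: (int0_le (cont_off0M cW cf) (int0Z C Inf)) => x x0.
by rewrite normrM ler_wpM2r // WC.
Qed.

Lemma int0_dircos i f : cont_off0 f -> int0 f -> int0 (fun x => dircos i x * f x).
Proof. by apply: (@int0_bounded 1); [exact: cont_dircos | move=> x; exact: dircos_le1]. Qed.

Lemma supp_bounded M f : continuous f -> supp M f ->
  exists2 C, 0 <= C & forall x, `|f x| <= C * \1_(cube R n M) x.
Proof.
move=> cf sf.
have cb : compact (cube R n M).
  have := @rV_compact R n (fun=> `[- M, M]%classic) (fun=> @segment_compact R (-M) M).
  congr compact; apply/seteqP; split => x Hx i.
    by have := Hx i; rewrite /= in_itv /= -ler_norml.
  by rewrite /= in_itv /= -ler_norml; exact: Hx.
have [C [_ HC]] : bounded_set (f @` cube R n M).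
  by apply/compact_bounded/continuous_compact => //; exact: continuous_subspaceT.
exists (`|C| + 1); first by rewrite addr_ge0.
move=> x; rewrite indicE; case: (boolP (x \in cube R n M)) => /= xb.
  rewrite mulr1; apply: HC; first by rewrite (le_lt_trans (ler_norm C)) // ltrDl.
  by exists x => //; rewrite inE in xb.
rewrite mulr0; move: xb; rewrite notin_setE /cube /= -existsNE => -[k /negP].
by rewrite -ltNge => /sf ->; rewrite normr0.
Qed.

(** The local integrability of |x|^-2, available because n >= 3. *)
Lemma L2_inv_enorm M f : (3 <= n)%N -> 0 < M -> continuous f -> supp M f ->
  L2 (fun x => (enorm x)^-1 * f x).
Proof.
move=> n3 M0 cf sf; have [C C0 fC] := supp_bounded cf sf.
have cF : cont_off0 (fun x => (enorm x)^-1 * f x).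
  by apply: cont_off0M; [exact: cont_off0_inv_enorm | exact: cont_off0_continuous].
split => //.
have I1 : int0 (fun x => \1_(cube R n M) x * (enorm x ^+ 2)^-1).
  by apply: integrableS (integrable_inv_sqr n3 M0) => //.
apply: (int0_le (cont_off0M cF cF) (int0Z (C ^+ 2) I1)) => x x0.
rewrite -expr2 ger0_norm ?sqr_ge0 // exprMn exprVn [leLHS]mulrC mulrA ler_wpM2r ?invr_ge0 ?sqr_ge0 //.
have h := fC x; rewrite -(real_normK (num_real (f x))).
rewrite (le_trans (y := (C * \1_(cube R n M) x) ^+ 2)) //.
  by rewrite lerXn2r ?nnegrE // (le_trans _ h).
by rewrite exprMn ler_wpM2l ?sqr_ge0 // indicE; case: (_ \in _); rewrite ?expr1n ?expr0n.
Qed.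

Lemma L2_supp M f : (3 <= n)%N -> 0 < M -> continuous f -> supp M f -> L2 f.
Proof.
move=> n3 M0 cf sf.
have : L2 (fun x => (enorm x)^-1 * (enorm x * f x)).
  apply: (@L2_inv_enorm M) => //; last by move=> x k /sf ->; rewrite mulr0.
  by move=> x; apply: (@continuousM _ _ (@enorm R n)); [exact: continuous_enorm | exact: cf].
apply: L2_ext; last exact: cont_off0_continuous.
by move=> x x0; rewrite mulrA mulVf ?mul1r // gt_eqF // enorm_gt0.
Qed.

(** The divergence of the field W Q x, by Euler's identity for the homogeneous
    factor W. *)
Lemma null_euler M (s : R) W Q (dQ : 'I_n -> rV -> R) :
  homogeneous s W ->
  (forall i x, x != 0 -> is_derive x 'e_i Q (dQ i x)) ->
  cont_off0 Q -> (forall i, cont_off0 (dQ i)) -> supp M Q ->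
  int0 (fun x => W x * Q x) ->
  (forall i, int0 (fun x => W x * (x ord0 i * dQ i x))) ->
  null (fun x => W x * ((n%:R + s) * Q x + \sum_i x ord0 i * dQ i x)).
Proof.
move=> [cW dW] dQE cQ cdQ sQ IQ IdQ.
pose F i x := W x * Q x + s * (dircos i x * (dircos i x * (W x * Q x)))
  + W x * (x ord0 i * dQ i x).
have cWQ := cont_off0M cW cQ.
have cF i : cont_off0 (F i).
  apply: cont_off0D; last first.
    apply: cont_off0M => //; apply: cont_off0M => //; exact: cont_off0_coord.
  apply: cont_off0D => //; apply: cont_off0M; first exact: cont_off0_cst.
  by do 2 (apply: cont_off0M; first exact: cont_dircos).
have nF i : null (F i).
  apply: (@null_partial M i (fun x => x ord0 i * (W x * Q x))) => //.
  - move=> x x0; apply: is_derive_eq.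
      apply: is_deriveM (is_derive_coord x i i) _.
      exact: is_deriveM (dW x i x0) (dQE i x x0).
    by rewrite /F /dircos /GRing.scale /= eqxx mulr1; ring.
  - by move=> x k /sQ ->; rewrite !mulr0.
  - apply: int0D => //; apply: int0D => //; apply: int0Z.
    apply: int0_dircos; first by apply: cont_off0M => //; exact: cont_dircos.
    exact: int0_dircos.
apply: null_ext (null_sum nF) => x x0.
rewrite /F !big_split /= sumr_const card_ord -!mulr_sumr -mulr_natl.
rewrite (eq_bigr (fun i => dircos i x ^+ 2 * (W x * Q x))); last by move=> i _; ring.
by rewrite -mulr_suml sum_sqr_dircos //; ring.
Qed.

End punctured_integrals.

(** * Divergence identities for a gradient field *)

Section jets.
Context {R : realType} (n : nat) (n5 : (5 <= n)%N).
Notation rV := 'rV[R]_n.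
Notation "''e_' i" := (delta_mx ord0 i : rV) (at level 8, i at level 2, format "''e_' i").
Notation mu := (lebesgue_rV R n).
Notation D := [set~ (0 : rV)].

Let n2 : (2 <= n)%N. Proof. exact: leq_trans n5. Qed.
Let n3 : (3 <= n)%N. Proof. exact: leq_trans n5. Qed.

(* g, h, k stand for the components of the first, second and third derivatives
   of u; the symmetry hypotheses are those of Schwarz's theorem *)
Variables (M : R) (g : 'I_n -> rV -> R) (h : 'I_n -> 'I_n -> rV -> R)
  (k : 'I_n -> 'I_n -> 'I_n -> rV -> R).
Hypotheses (M0 : 0 < M)
  (dg : forall i j x, is_derive x 'e_j (g i) (h i j x))
  (dh : forall i j l x, is_derive x 'e_l (h i j) (k i j l x))
  (cg : forall i, continuous (g i)) (ch : forall i j, continuous (h i j))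
  (ck : forall i j l, continuous (k i j l))
  (sg : forall i, supp M (g i)) (sh : forall i j, supp M (h i j))
  (sk : forall i j l, supp M (k i j l))
  (hC : forall i j x, h i j x = h j i x)
  (kC : forall i j l x, k i j l x = k j i l x)
  (kCr : forall i j l x, k i j l x = k i l j x).

Notation v x := ((enorm x)^-1).

(** The vector H x of the Hessian matrix H applied to the position; in the same
    way hquad is x . H x, gdot is x . g and ghdot is g . H x. *)
Definition hdot i (x : rV) : R := \sum_j x ord0 j * h i j x.
Definition hquad (x : rV) : R := \sum_i x ord0 i * hdot i x.
Definition gdot (x : rV) : R := \sum_i x ord0 i * g i x.
Definition gsqr (x : rV) : R := \sum_i g i x ^+ 2.
Definition ghdot (x : rV) : R := \sum_i g i x * hdot i x.
Definition htr (x : rV) : R := \sum_i h i i x.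

Lemma continuous_dot (F : 'I_n -> rV -> R) : (forall i, continuous (F i)) ->
  continuous (fun x : rV => \sum_i x ord0 i * F i x).
Proof.
move=> cF x; apply: continuous_sum => i.
by apply: (@continuousM _ _ (fun x : rV => x ord0 i)); [exact: coord_continuous | exact: cF].
Qed.

Lemma supp_dot (F : 'I_n -> rV -> R) : (forall i, supp M (F i)) ->
  supp M (fun x : rV => \sum_i x ord0 i * F i x).
Proof. by move=> sF x l Ml; rewrite big1 // => i _; rewrite (sF i x l Ml) mulr0. Qed.

Lemma is_derive_dot (F : 'I_n -> rV -> R) (dF : 'I_n -> rV -> R) x i :
  (forall j, is_derive x 'e_i (F j) (dF j x)) ->
  is_derive x 'e_i (fun x : rV => \sum_j x ord0 j * F j x) (F i x + \sum_j x ord0 j * dF j x).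
Proof.
move=> dFj.
apply: (is_derive_bigsum (fun j => is_derive_mul (is_derive_coord x i j) (dFj j) erefl)).
rewrite big_split /= [RHS]addrC; congr (_ + _).
rewrite (bigD1 i) //= eqxx big1.
  by rewrite mulr1 addr0.
by move=> j ji; rewrite eq_sym (negbTE ji) mulr0.
Qed.

Let chdot i : continuous (hdot i). Proof. exact: continuous_dot. Qed.
Let chquad : continuous hquad. Proof. exact: continuous_dot. Qed.
Let cgdot : continuous gdot. Proof. exact: continuous_dot. Qed.
Let shdot i : supp M (hdot i). Proof. exact: supp_dot. Qed.
Let shquad : supp M hquad. Proof. exact: supp_dot. Qed.
Let sgdot : supp M gdot. Proof. exact: supp_dot. Qed.

Let kdot i j (x : rV) : R := \sum_l x ord0 l * k i j l x.
Let ckdot i j : continuous (kdot i j). Proof. exact: continuous_dot. Qed.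
Let skdot i j : supp M (kdot i j). Proof. exact: supp_dot. Qed.

Let dhdot i j x : is_derive x 'e_j (hdot i) (h i j x + kdot i j x).
Proof.
apply: (is_derive_eq (is_derive_dot (dF := fun l => k i l j) (fun l => dh i l j x))).
by congr (_ + _); apply: eq_bigr => l _; rewrite kCr.
Qed.

Let kquad i (x : rV) : R := \sum_j x ord0 j * kdot i j x.

Let dhquad i x : is_derive x 'e_i hquad (2 * hdot i x + kquad i x).
Proof.
apply: (is_derive_eq (is_derive_dot (dF := fun l x => h l i x + kdot l i x) (fun l => dhdot l i x))).
rewrite mulr_natl mulr2n -addrA; congr (_ + _).
rewrite /hdot /kquad -big_split /=; apply: eq_bigr => j _.
rewrite mulrDr hC; congr (_ * _ + _ * _).
by apply: eq_bigr => l _; rewrite kC.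
Qed.

Let dgdot i x : is_derive x 'e_i gdot (g i x + hdot i x).
Proof.
apply: (is_derive_eq (is_derive_dot (dF := fun l => h l i) (fun l => dg l i x))).
by congr (_ + _); apply: eq_bigr => j _; rewrite hC.
Qed.

Let c0 (F : rV -> R) : continuous F -> cont_off0 F.
Proof. exact: cont_off0_continuous. Qed.
Let cv : cont_off0 (fun x : rV => v x). Proof. exact: cont_off0_inv_enorm. Qed.

Let L2h i j : L2 (h i j). Proof. exact: (L2_supp n3 M0). Qed.
Let L2kdot i j : L2 (kdot i j). Proof. exact: (L2_supp n3 M0). Qed.
Let L2vg i : L2 (fun x : rV => v x * g i x). Proof. exact: (L2_inv_enorm n3 M0). Qed.

Let L2vdot (F : 'I_n -> rV -> R) (W : rV -> R) : cont_off0 W -> 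
  (forall i, cont_off0 (F i)) -> (forall i, L2 (fun x : rV => W x * F i x)) ->
  L2 (fun x : rV => W x * v x * \sum_i x ord0 i * F i x).
Proof.
move=> cW cF LF; apply: L2_ext (L2_sum (fun i => L2_dircos i (LF i))).
  by move=> x x0; rewrite mulr_sumr; apply: eq_bigr => i _; rewrite /dircos; ring.
apply: cont_off0M; first exact: cont_off0M.
by apply: cont_off0_sum => i; apply: cont_off0M => //; exact: cont_off0_coord.
Qed.

Let L2vdot1 (F : 'I_n -> rV -> R) : (forall i, continuous (F i)) ->
  (forall i, L2 (F i)) -> L2 (fun x : rV => v x * \sum_i x ord0 i * F i x).
Proof.
move=> cF LF; apply: L2_ext (L2_sum (fun i => L2_dircos i (LF i))).
  by move=> x x0; rewrite mulr_sumr; apply: eq_bigr => i _; rewrite /dircos; ring.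
by apply: cont_off0M => //; apply: c0; exact: continuous_dot.
Qed.

Let L2vhdot i : L2 (fun x : rV => v x * hdot i x). Proof. exact: L2vdot1. Qed.
Let L2vkquad i : L2 (fun x : rV => v x * kquad i x). Proof. exact: L2vdot1. Qed.
Let L2vvhquad : L2 (fun x : rV => v x * v x * hquad x).
Proof. by apply: L2vdot => // i; exact: c0. Qed.
Let L2vvgdot : L2 (fun x : rV => v x * v x * gdot x).
Proof. by apply: L2vdot => // i; exact: c0. Qed.

(** (Delta u)^2 - |Hess u|^2 is a divergence; the third derivatives cancel by
    symmetry. *)
Lemma null_bochner : null (fun x : rV => htr x ^+ 2 - \sum_i \sum_j h i j x ^+ 2).
Proof.
have n1 i j : null (fun x : rV => h i i x * h j j x + g i x * k j j i x).
  apply: (@null_partial _ _ n2 M i (fun x : rV => g i x * h j j x)).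
  - move=> x _; apply: (is_derive_mul (dg i i x) (dh j j i x)); ring.
  - by apply: cont_off0D; apply: cont_off0M; apply: c0.
  - by move=> x l /sg ->; rewrite mul0r.
  - by apply: int0D; apply: L2M => //; exact: (L2_supp n3 M0).
have n2' i j : null (fun x : rV => h i j x * h j i x + g i x * k j i j x).
  apply: (@null_partial _ _ n2 M j (fun x : rV => g i x * h j i x)).
  - move=> x _; apply: (is_derive_mul (dg i j x) (dh j i j x)); ring.
  - by apply: cont_off0D; apply: cont_off0M; apply: c0.
  - by move=> x l /sg ->; rewrite mul0r.
  - by apply: int0D; apply: L2M => //; exact: (L2_supp n3 M0).
apply: null_ext (null_sum (fun i => null_sum (fun j => nullD (n1 i j) (nullZ (-1) (n2' i j))))).
move=> x _; rewrite expr2 {1}/htr mulr_suml -sumrB; apply: eq_bigr => i _.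
rewrite /htr mulr_sumr -sumrB; apply: eq_bigr => j _.
by rewrite (kCr j j i) (hC j i); ring.
Qed.

Section weight.
Variables (b : R) (W : rV -> R).
Hypotheses (hW : homogeneous (- b) W) (LW : forall i, L2 (fun x : rV => W x * g i x)).

Let cW : cont_off0 W. Proof. by case: hW. Qed.

Let dgsqr i x : is_derive x 'e_i gsqr (\sum_j 2 * g j x * h j i x).
Proof.
have -> : gsqr = fun x => \sum_j g j x * g j x.
  by apply/funext => y; apply: eq_bigr => j _; rewrite expr2.
apply: (is_derive_bigsum (fun j => is_derive_mul (dg j i x) (dg j i x) erefl)).
by apply: eq_bigr => j _; ring.
Qed.

Lemma int0_W_gsqr : int0 (fun x : rV => W x * v x * gsqr x).
Proof.
apply: int0_ext (int0_sum (fun i => L2M (LW i) (L2vg i))) => x _.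
by rewrite mulr_sumr; apply: eq_bigr => i _; ring.
Qed.

(** The divergence of W |x|^-1 |g|^2 x; W is typically |x|^-b, and |x|^-1 when b
    = 1. *)
Lemma null_gsqr : null (fun x : rV => W x * v x * ((n%:R - b - 1) * gsqr x + 2 * ghdot x)).
Proof.
have := @null_euler _ _ n2 M _ _ gsqr (fun i x => \sum_j 2 * g j x * h j i x)
  (homogeneousM hW (@homogeneous_inv_enorm R n)) (fun i x _ => dgsqr i x).
have cdg i : cont_off0 (fun x : rV => \sum_j 2 * g j x * h j i x).
  apply: cont_off0_sum => j; apply: cont_off0M; last exact: c0.
  by apply: cont_off0M; [exact: cont_off0_cst | exact: c0].
move=> /(_ _ cdg _ int0_W_gsqr) H.
apply: null_ext (H _ _ _).
- move=> x x0; congr (_ * (_ + _)); first by ring.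
  under eq_bigr do rewrite mulr_sumr.
  rewrite exchange_big /= /ghdot mulr_sumr; apply: eq_bigr => j _.
  by rewrite /hdot !mulr_sumr; apply: eq_bigr => i _; ring.
- by apply: cont_off0_sum => i; apply: cont_off0M; exact: c0.
- by move=> x l Hl; rewrite /gsqr big1 // => i _; rewrite (sg i Hl) expr0n.
- move=> i; apply: int0_ext (int0Z 2 (int0_sum (fun j => L2M (L2_dircos i (LW j)) (L2h j i)))).
  by move=> x _; rewrite !mulr_sumr; apply: eq_bigr => j _; rewrite /dircos; ring.
Qed.

Let L2Wvgdot : L2 (fun x : rV => W x * v x * gdot x).
Proof. by apply: L2vdot => // i; exact: c0. Qed.

(** The divergence of W |x|^-3 (x . g)^2 x, which sees the radial part of g only. *)
Lemma null_gdot : null (fun x : rV => W x * v x ^+ 3 *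
  ((n%:R - b - 1) * gdot x ^+ 2 + 2 * (gdot x * hquad x))).
Proof.
have hv := @homogeneous_inv_enorm R n.
have dU i x : is_derive x 'e_i (fun x : rV => gdot x * gdot x) (2 * gdot x * (g i x + hdot i x)).
  apply: (is_derive_mul (dgdot i x) (dgdot i x)); ring.
have := @null_euler _ _ n2 M _ _ _ _
  (homogeneousM hW (homogeneousM hv (homogeneousM hv hv))) (fun i x _ => dU i x).
have cdU i : cont_off0 (fun x : rV => 2 * gdot x * (g i x + hdot i x)).
  apply: cont_off0M; first by apply: cont_off0M; [exact: cont_off0_cst | exact: c0].
  by apply: cont_off0D; exact: c0.
have IU : int0 (fun x : rV => W x * (v x * (v x * v x)) * (gdot x * gdot x)).
  by apply: int0_ext (L2M L2Wvgdot L2vvgdot) => x _; ring.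
move=> /(_ _ cdU _ IU) H.
apply: null_ext (H _ _ _).
- move=> x x0.
  rewrite (_ : \sum_i x ord0 i * (2 * gdot x * (g i x + hdot i x)) =
     2 * gdot x * (gdot x + hquad x)); first by ring.
  have -> : gdot x + hquad x = \sum_i x ord0 i * (g i x + hdot i x).
    by rewrite -big_split /=; apply: eq_bigr => i _; rewrite mulrDr.
  by rewrite mulr_sumr; apply: eq_bigr => i _; ring.
- by apply: cont_off0M; exact: c0.
- by move=> x l Hl; rewrite (sgdot Hl) mul0r.
- move=> i; apply: int0_ext (int0Z 2 (L2M (L2_dircos i L2Wvgdot) (L2D (L2vg i) (L2vhdot i)))).
  by move=> x _; rewrite /dircos; ring.
Qed.

End weight.

(** The divergence of |x|^-2 ((x . H x) g - (g . H x) x), a combination chosen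
    so that the third derivatives cancel. It turns the term (x . H x) Delta u,
    left over by the trace inequality, into first derivatives and |H x|^2. *)
Lemma null_radial : null (fun x : rV => v x ^+ 2 * (hquad x * htr x
  - (n%:R - 3) * ghdot x - (\sum_i hdot i x ^+ 2) - 2 * (hquad x * gdot x * v x ^+ 2))).
Proof.
have hv := @homogeneous_inv_enorm R n.
have [cvv dvv] := homogeneousM hv hv.
have nA i : null (fun x : rV => v x * v x * (hquad x * h i i x)
    + v x * v x * (g i x * (2 * hdot i x + kquad i x))
    + (-2) * (dircos i x * (v x * v x * hquad x) * (v x * g i x))).
  have cvvq : cont_off0 (fun x : rV => v x * v x * hquad x) by apply: cont_off0M => //; exact: c0.
  apply: (@null_partial _ _ n2 M i (fun x : rV => (v x * v x) * (hquad x * g i x))).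
  - move=> x x0; apply: (is_derive_mul (dvv x i x0) (is_derive_mul (dhquad i x) (dg i i x) erefl)).
    by rewrite /dircos; ring.
  - apply: cont_off0D; first apply: cont_off0D.
    + by apply: cont_off0M => //; apply: cont_off0M; exact: c0.
    + apply: cont_off0M => //; apply: cont_off0M; first exact: c0.
      apply: cont_off0D; last by apply: c0; exact: continuous_dot.
      by apply: cont_off0M; [exact: cont_off0_cst | exact: c0].
    + apply: cont_off0M; first exact: cont_off0_cst.
      apply: cont_off0M; last by apply: cont_off0M => //; exact: c0.
      by apply: cont_off0M => //; exact: cont_dircos.
  - by move=> x l Hl; rewrite (sg i Hl) !mulr0.
  - apply: int0D; first apply: int0D.
    + by apply: int0_ext (L2M L2vvhquad (L2h i i)) => x _; ring.
    + apply: int0_ext (L2M (L2vg i) (L2D (L2Z 2 (L2vhdot i)) (L2vkquad i))) => x _.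
      by ring.
    + by apply: int0Z; apply: L2M => //; exact: L2_dircos.
have dS i x : is_derive x 'e_i ghdot
    (\sum_j (h j i x * hdot j x + g j x * (h j i x + kdot j i x))).
  apply: (is_derive_bigsum (fun j => is_derive_mul (dg j i x) (dhdot j i x) erefl)).
  by apply: eq_bigr => j _; ring.
have nB := @null_euler _ _ n2 M _ _ _ _ (homogeneousM hv hv) (fun i x _ => dS i x).
have IS : int0 (fun x : rV => v x * v x * ghdot x).
  apply: int0_ext (int0_sum (fun i => L2M (L2vg i) (L2vhdot i))) => x _.
  by rewrite mulr_sumr; apply: eq_bigr => i _; ring.
have cdS i : cont_off0 (fun x : rV => \sum_j (h j i x * hdot j x + g j x * (h j i x + kdot j i x))).
  apply: cont_off0_sum => j; apply: cont_off0D; apply: cont_off0M; try exact: c0.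
  by apply: cont_off0D; exact: c0.
have {}nB := nB _ cdS _ IS.
have := nullD (null_sum nA) (nullZ (-1) (nB _ _ _)).
move=> H; apply: null_ext (H _ _ _).
- move=> x _.
  have zE : \sum_i x ord0 i * \sum_j (h j i x * hdot j x + g j x * (h j i x + kdot j i x)) =
      \sum_j hdot j x ^+ 2 + ghdot x + \sum_j g j x * kquad j x.
    under eq_bigr do rewrite mulr_sumr.
    rewrite exchange_big /= -!big_split /=; apply: eq_bigr => j _.
    transitivity ((\sum_i x ord0 i * h j i x) * hdot j x
        + g j x * (\sum_i x ord0 i * h j i x) + g j x * \sum_i x ord0 i * kdot j i x).
      rewrite mulr_suml !mulr_sumr -!big_split /=; apply: eq_bigr => i _; ring.
    by rewrite expr2.
  rewrite zE !big_split /= -!mulr_sumr -/(htr x).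
  rewrite (eq_bigr (fun i => 2 * (g i x * hdot i x) + g i x * kquad i x)); last by move=> i _; ring.
  rewrite big_split /= -mulr_sumr -/(ghdot x).
  have -> : \sum_i dircos i x * (v x * v x * hquad x) * (v x * g i x) =
      v x ^+ 4 * hquad x * gdot x.
    by rewrite /gdot [RHS]mulr_sumr; apply: eq_bigr => i _; rewrite /dircos; ring.
  by ring.
- by apply: cont_off0_sum => i; apply: cont_off0M; exact: c0.
- by move=> x l Hl; rewrite /ghdot big1 // => i _; rewrite (sg i Hl) mul0r.
- move=> i; apply: int0_ext (int0_sum (fun j => int0D
     (L2M (L2_dircos i (L2h j i)) (L2vhdot j))
     (L2M (L2_dircos i (L2vg j)) (L2D (L2h j i) (L2kdot j i))))).
  by move=> x _; rewrite !mulr_sumr; apply: eq_bigr => j _; rewrite /dircos; ring.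
Qed.


(** pointwise_certificate at a point, with the lengths scaled by |x| as
    explained there. *)
Lemma pointwise_weighted (b m K : R) (W : rV -> R) (x : rV)
    (al := Num.sqrt 2 : R) (be := (al * (n%:R - 4) + K) / 2)
    (c := (K + n%:R - 2) / 2) (r2 := n%:R - 2 : R) :
  x != 0 -> 0 <= W x -> 0 <= m * (1 - b) -> K ^+ 2 = n%:R ^+ 2 ->
  (n%:R - 1) / r2 * (htr x ^+ 2 - \sum_i \sum_j h i j x ^+ 2)
  + - (2 / r2) * (v x ^+ 2 * (hquad x * htr x - (n%:R - 3) * ghdot x
       - (\sum_i hdot i x ^+ 2) - 2 * (hquad x * gdot x * v x ^+ 2)))
  + - ((n%:R - 3) / r2 + 2 + al * be) *
      (v x * v x * ((n%:R - 1 - 1) * gsqr x + 2 * ghdot x))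
  + - (2 / r2 + c - 2 - al * be) *
      (v x * v x ^+ 3 * ((n%:R - 1 - 1) * gdot x ^+ 2 + 2 * (gdot x * hquad x)))
  + - (al * m) * (W x * v x * ((n%:R - b - 1) * gsqr x + 2 * ghdot x))
  + (al - 1) * m * (W x * v x ^+ 3 *
      ((n%:R - b - 1) * gdot x ^+ 2 + 2 * (gdot x * hquad x)))
  <= htr x ^+ 2 + m ^+ 2 * (W x ^+ 2 * gsqr x) + m * (K + b - 1) * (W x * v x * gsqr x).
Proof.
move=> x0 W0 mb K2; have r0 := enorm_gt0 x0.
have rv : enorm x * v x = 1 by rewrite divff // gt_eqF.
have al2 : al ^+ 2 = 2 by rewrite sqr_sqrtr.
have al1 : 1 <= al by rewrite -(sqrtr1 R) ler_wsqrtr // ler1n.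
have t1 := sum_sqr_dircos x0.
pose Yt i := \sum_j dircos j x * h i j x.
have YE i : Yt i = v x * hdot i x.
  by rewrite /Yt /hdot [RHS]mulr_sumr; apply: eq_bigr => j _; rewrite /dircos; ring.
have aE : \sum_i dircos i x * Yt i = v x ^+ 2 * hquad x.
  by rewrite /hquad [RHS]mulr_sumr; apply: eq_bigr => j _; rewrite YE /dircos; ring.
have Y2E : \sum_i Yt i ^+ 2 = v x ^+ 2 * \sum_i hdot i x ^+ 2.
  by rewrite [RHS]mulr_sumr; apply: eq_bigr => j _; rewrite YE; ring.
have pE : \sum_i dircos i x * (v x * g i x) = v x ^+ 2 * gdot x.
  by rewrite /gdot [RHS]mulr_sumr; apply: eq_bigr => j _; rewrite /dircos; ring.
have GE : \sum_i (v x * g i x) ^+ 2 = v x ^+ 2 * gsqr x.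
  by rewrite /gsqr [RHS]mulr_sumr; apply: eq_bigr => j _; ring.
have ZE : \sum_i Yt i * (v x * g i x) = v x ^+ 2 * ghdot x.
  by rewrite /ghdot [RHS]mulr_sumr; apply: eq_bigr => j _; rewrite YE; ring.
pose w := m * W x * enorm x.
have Hess := hessian_sqr_ge (H := fun i j => h i j x) n2 t1 (fun i j => hC i j x).
rewrite -/Yt aE Y2E -/(htr x) in Hess.
pose V i := al * (Yt i + v x * g i x) + (be + w) * (v x * g i x).
have CS := unit_dot_sqr_le V t1.
have VE : \sum_i dircos i x * V i = al * (v x ^+ 2 * hquad x + v x ^+ 2 * gdot x)
    + (be + w) * (v x ^+ 2 * gdot x).
  rewrite -{1}aE -pE mulrDr !mulr_sumr -!big_split /=; apply: eq_bigr => i _.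
  by rewrite /V; ring.
have V2E : \sum_i V i ^+ 2 = al ^+ 2 * (v x ^+ 2 * \sum_i hdot i x ^+ 2
    + 2 * (v x ^+ 2 * ghdot x) + v x ^+ 2 * gsqr x)
    + 2 * al * (be + w) * (v x ^+ 2 * ghdot x + v x ^+ 2 * gsqr x)
    + (be + w) ^+ 2 * (v x ^+ 2 * gsqr x).
  rewrite -Y2E -ZE -GE mulr_sumr -!big_split /= !mulr_sumr -!big_split /=.
  by apply: eq_bigr => i _; rewrite /V; ring.
rewrite VE V2E in CS.
have PG := unit_dot_sqr_le (fun i => v x * g i x) t1; rewrite pE GE in PG.
have nR : 5 <= n%:R :> R by rewrite ler_nat.
have wb : 0 <= w * (1 - b).
  rewrite (_ : _ * _ = m * (1 - b) * (W x * enorm x)); last by rewrite /w; ring.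
  by rewrite mulr_ge0 // mulr_ge0 // enorm_ge0.
have := pointwise_certificate nR al2 al1 K2 erefl erefl wb Hess CS PG.
rewrite -/be -/c -/r2.
have wv (z : R) : w * (v x ^+ 2 * z) = m * W x * v x * z.
  by rewrite -[m * W x * v x]mulr1 -rv /w; ring.
have wv2 (z : R) : w * (v x ^+ 4 * z) = m * W x * v x ^+ 3 * z.
  by rewrite -[m * W x * v x ^+ 3]mulr1 -rv /w; ring.
have wvv : w ^+ 2 * (v x ^+ 2 * gsqr x) = m ^+ 2 * (W x ^+ 2 * gsqr x).
  have -> : w ^+ 2 * (v x ^+ 2 * gsqr x) =
     m ^+ 2 * (W x ^+ 2 * gsqr x) * (enorm x * v x) ^+ 2 by rewrite /w; ring.
  by rewrite rv expr1n mulr1.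
have -> : w * ((n%:R - b - 1) * (v x ^+ 2 * gsqr x) + 2 * (v x ^+ 2 * ghdot x)) =
    m * (W x * v x * ((n%:R - b - 1) * gsqr x + 2 * ghdot x)).
  rewrite (_ : w * _ = w * (v x ^+ 2 * ((n%:R - b - 1) * gsqr x + 2 * ghdot x))); last by ring.
  by rewrite wv; ring.
have -> : w * ((n%:R - b - 1) * (v x ^+ 2 * gdot x) ^+ 2 +
      2 * (v x ^+ 2 * gdot x * (v x ^+ 2 * hquad x))) =
    m * (W x * v x ^+ 3 * ((n%:R - b - 1) * gdot x ^+ 2 + 2 * (gdot x * hquad x))).
  rewrite (_ : w * _ = w * (v x ^+ 4 *
    ((n%:R - b - 1) * gdot x ^+ 2 + 2 * (gdot x * hquad x)))); last by ring.
  by rewrite wv2; ring.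
rewrite wvv.
have -> : (K + b - 1) * w * (v x ^+ 2 * gsqr x) = m * (K + b - 1) * (W x * v x * gsqr x).
  by rewrite -mulrA wv; ring.
move=> H; apply: le_trans H; rewrite le_eqVlt; apply/orP; left; apply/eqP.
by rewrite /r2; ring.
Qed.

Lemma int0_htr : int0 (fun x : rV => htr x ^+ 2).
Proof. by have [] := L2_sum (fun i => L2h i i). Qed.

Lemma int0_W2_gsqr (W : rV -> R) : (forall i, L2 (fun x : rV => W x * g i x)) ->
  int0 (fun x : rV => W x ^+ 2 * gsqr x).
Proof.
move=> LW; apply: int0_ext (int0_sum (fun i => (LW i).2)) => x _.
by rewrite /gsqr mulr_sumr; apply: eq_bigr => i _; ring.
Qed.

(** The integrated form of the pointwise inequality; m is the coefficient of the
    weight in the completed square, and K = n or -n selects the regime. *)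
Lemma weighted_inequality (b m K : R) (W : rV -> R) :
  homogeneous (- b) W -> (forall x, 0 <= W x) ->
  (forall i, L2 (fun x : rV => W x * g i x)) ->
  0 <= m * (1 - b) -> K ^+ 2 = n%:R ^+ 2 ->
  (0 <= \int[mu]_(x in D) (htr x ^+ 2)%:E
        + (m ^+ 2)%:E * \int[mu]_(x in D) (W x ^+ 2 * gsqr x)%:E
        + (m * (K + b - 1))%:E * \int[mu]_(x in D) (W x * v x * gsqr x)%:E)%E.
Proof.
move=> hW W0 LW mb K2.
have hv := @homogeneous_inv_enorm R n.
have IA := int0_htr; have IB := int0_W2_gsqr LW; have IE := int0_W_gsqr LW.
have [L [[IL L0] LT]] : exists L, null L /\ forall x, x != 0 ->
    L x <= htr x ^+ 2 + m ^+ 2 * (W x ^+ 2 * gsqr x) + m * (K + b - 1) * (W x * v x * gsqr x).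
  (* L is the combination of null functions on the left of pointwise_weighted;
     matching it first leaves no coefficient to be written *)
  eexists; split; last by move=> x x0; exact: (pointwise_weighted x0 (W0 x) mb K2).
  apply: nullD (nullZ _ (null_gdot hW LW)); apply: nullD (nullZ _ (null_gsqr hW LW)).
  apply: nullD (nullZ _ (null_gdot hv L2vg)); apply: nullD (nullZ _ (null_gsqr hv L2vg)).
  exact: nullD (nullZ _ null_bochner) (nullZ _ null_radial).
have mD : measurable D by apply: measurableC; exact: measurable_rV0.
have IT := int0D (int0D IA (int0Z (m ^+ 2) IB)) (int0Z (m * (K + b - 1)) IE).
have : (\int[mu]_(x in D) (L x)%:E <= \int[mu]_(x in D) (htr x ^+ 2 +
    m ^+ 2 * (W x ^+ 2 * gsqr x) + m * (K + b - 1) * (W x * v x * gsqr x))%:E)%E.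
  by apply: le_integral => // x; rewrite inE => /eqP x0; rewrite lee_fin LT.
rewrite L0 => /le_trans; apply.
under eq_integral do rewrite EFinD EFinD.
rewrite integralD //; [|exact: int0D IA (int0Z _ IB)|exact: int0Z].
rewrite integralD //; last exact: int0Z.
under [X in (_ + X + _)%E]eq_integral do rewrite EFinM.
under [X in (_ + X)%E]eq_integral do rewrite EFinM.
by rewrite !integralZl.
Qed.

End jets.

(** * The weighted inequality for every exponent *)

Section sharp_constant.
Context {R : realType}.
Local Open Scope ereal_scope.

(** The usual optimization l^2 = A / B of a quadratic inequality, with A or B
    possibly zero. *)
Lemma optimize_scale (A B E : \bar R) (C : R) : (0 <= C)%R ->
  0 <= A -> A < +oo -> 0 <= B -> B < +oo -> 0 <= E -> E < +oo ->
  (forall l : R, (0 < l)%R -> (l * C)%:E * E <= A + (l ^+ 2)%:E * B) ->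
  (C / 2)%:E * E <= A `^ 2^-1 * B `^ 2^-1.
Proof.
move=> C0; case: A => [A| |] //; rewrite lee_fin => A0 _.
case: B => [B| |] //; rewrite lee_fin => B0 _.
case: E => [E| |] //; rewrite lee_fin => E0 _ H.
have {}H (l : R) : (0 < l -> l * C * E <= A + l ^+ 2 * B)%R.
  by move=> /H; rewrite -!EFinM -EFinD lee_fin.
rewrite !poweR_EFin -!EFinM lee_fin !powR12_sqrt //.
pose a : R := Num.sqrt A; pose b : R := Num.sqrt B; rewrite -/a -/b.
have a0 : (0 <= a)%R by exact: sqrtr_ge0.
have b0 : (0 <= b)%R by exact: sqrtr_ge0.
have AE : A = (a ^+ 2)%R by rewrite sqr_sqrtr.
have BE : B = (b ^+ 2)%R by rewrite sqr_sqrtr.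
apply/ler_addgt0Pr => e e0.
(* l = (a + d) / (b + d) with d > 0 avoids a division by zero and the separate
   treatment of A = 0 and B = 0 *)
have [d [d0 Hd]] : exists d : R, (0 < d /\ (a + d) * (b + d) <= a * b + e)%R.
  pose s := (a + b + 1)%R; have s0 : (0 < s)%R by rewrite /s; lra.
  exists (Num.min 1 (e / s))%R; split; first by rewrite lt_min ltr01 divr_gt0.
  set d := Num.min _ _; have d1 : (d <= 1)%R by rewrite ge_min lexx.
  have d0 : (0 < d)%R by rewrite lt_min ltr01 divr_gt0.
  have ds : (d * s <= e)%R by rewrite -ler_pdivlMr // ge_min lexx orbT.
  have : (d * d <= d * 1)%R by rewrite ler_wpM2l // ltW.
  by move: ds; rewrite /s; nra.
apply: le_trans Hd.
have ad : (0 < a + d)%R by rewrite ltr_wpDl.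
have bd : (0 < b + d)%R by rewrite ltr_wpDl.
have := H ((a + d) / (b + d))%R (divr_gt0 ad bd).
have aa : (A <= (a + d) ^+ 2)%R by rewrite AE lerXn2r ?nnegrE ?(ltW ad) // lerDl ltW.
have bb : (B <= (b + d) ^+ 2)%R by rewrite BE lerXn2r ?nnegrE ?(ltW bd) // lerDl ltW.
move=> /le_trans /(_ (lerD aa (ler_wpM2l (sqr_ge0 _) bb))).
rewrite [leRHS](_ : _ = (a + d) / (b + d) * (2 * ((a + d) * (b + d))))%R; last first.
  by field; rewrite gt_eqF.
by rewrite -mulrA ler_pM2l ?divr_gt0 // => h; lra.
Qed.

End sharp_constant.

Section application.
Context {R : realType} (n : nat) (n5 : (5 <= n)%N).
Notation rV := 'rV[R]_n.
Notation "''e_' i" := (delta_mx ord0 i : rV) (at level 8, i at level 2, format "''e_' i").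
Notation mu := (lebesgue_rV R n).
Notation D := [set~ (0 : rV)].
Variables (u : rV -> R) (us : smooth u) (uc : compactly_supported u).

Lemma supp_partial M i (f : rV -> R) : supp M f -> supp M (partial i f).
Proof.
move=> sf x k Mx; rewrite /partial (near_eq_derive ('e_i) (g := cst 0)) ?derive_cst //.
have : (fun y : rV => `|y ord0 k|) @ x --> `|x ord0 k|.
  apply: (continuous_comp (f := fun y : rV => y ord0 k) (g := fun t : R => `|t|)).
    exact: coord_continuous.
  exact: norm_continuous.
by move=> /cvgr_gt /(_ _ Mx); apply: filterS => y /sf.
Qed.

Lemma compact_supp : exists2 M : R, 0 < M & supp M u.
Proof.
have [C [_ HC]] := compact_bounded uc.
exists (`|C| + 1); first by rewrite ltr_wpDl.
move=> x k Mx; apply/eqP; apply: contraTT Mx => ux; rewrite -leNgt.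
have /HC /(_ x) : C < `|C| + 1 by rewrite (le_lt_trans (ler_norm C)) // ltrDl.
have cx : closure [set x | u x != 0] x by exact: subset_closure.
move=> /(_ cx); apply: le_trans.
rewrite [leRHS]mx_normrE.
exact: (le_bigmax _ (fun i : 'I_1 * 'I_n => `|x i.1 i.2|) (ord0, k)).
Qed.

Let g i : rV -> R := partial i u.
Let h i j : rV -> R := partial j (partial i u).
Let k i j l : rV -> R := partial l (partial j (partial i u)).

Let cg i : continuous (g i). Proof. exact: (us [:: i]).1. Qed.
Let ch i j : continuous (h i j). Proof. exact: (us [:: j; i]).1. Qed.
Let ck i j l : continuous (k i j l). Proof. exact: (us [:: l; j; i]).1. Qed.

Let dg i j x : is_derive x 'e_j (g i) (h i j x).
Proof. exact/derivableP/((us [:: i]).2). Qed.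
Let dh i j l x : is_derive x 'e_l (h i j) (k i j l x).
Proof. exact/derivableP/((us [:: j; i]).2). Qed.

Let hC i j x : h i j x = h j i x.
Proof.
exact: (@derive_comm R n u i j x ((us [::]).2 i) ((us [::]).2 j)
  ((us [:: i]).2 j) ((us [:: j]).2 i) (us [:: j; i]).1 (us [:: i; j]).1).
Qed.

Let kC i j l x : k i j l x = k j i l x.
Proof.
have E : h i j = h j i by apply/funext => y; exact: hC.
by change (partial l (h i j) x = partial l (h j i) x); rewrite E.
Qed.

Let kCr i j l x : k i j l x = k i l j x.
Proof.
exact: (@derive_comm R n (partial i u) j l x ((us [:: i]).2 j) ((us [:: i]).2 l)
  ((us [:: j; i]).2 l) ((us [:: l; i]).2 j) (us [:: l; j; i]).1 (us [:: j; l; i]).1).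
Qed.

Let n2 : (2 <= n)%N. Proof. exact: leq_trans n5. Qed.
Let n3 : (3 <= n)%N. Proof. exact: leq_trans n5. Qed.

Let M := sval (cid2 compact_supp).
Let M0 : 0 < M. Proof. by rewrite /M; case: cid2. Qed.
Let su : supp M u. Proof. by rewrite /M; case: cid2. Qed.
Let sg i : supp M (g i). Proof. exact: supp_partial su. Qed.
Let sh i j : supp M (h i j). Proof. exact: supp_partial (sg i). Qed.
Let sk i j l : supp M (k i j l). Proof. exact: supp_partial (sh i j). Qed.

Lemma gsqr_gradient x : gsqr g x = enorm (gradient u x) ^+ 2.
Proof. by rewrite sqr_enorm; apply: eq_bigr => i _; rewrite mxE. Qed.

Let mD : measurable D. Proof. by apply: measurableC; exact: measurable_rV0. Qed.

(** The origin is negligible: this relates the integrands of the statement, with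
    their conventions at the origin, to integrals over the punctured space. *)
Lemma integral_off0 (f F : rV -> R) : cont_off0 F -> measurable_fun setT f ->
  (forall x, 0 <= f x) -> (forall x, x != 0 -> f x = F x) ->
  (\int[mu]_x (f x)%:E = \int[mu]_(x in D) (F x)%:E)%E.
Proof.
move=> cF mf f0 fF.
rewrite (ge0_negligible_integral (@measurable_rV0 R n)) //.
- rewrite setTD; apply: eq_integral => x; rewrite inE => /eqP x0; by rewrite fF.
- exact/measurable_EFinP.
- by move=> x _; rewrite lee_fin.
- by apply: lebesgue_rV0; exact: ltnW n2.
Qed.

Let c0 (F : rV -> R) : continuous F -> cont_off0 F.
Proof. exact: cont_off0_continuous. Qed.

Let cgsqr : cont_off0 (gsqr g).
Proof. by apply: cont_off0_sum => i; apply: cont_off0M; exact: c0. Qed.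

Lemma integral_laplacian : (\int[mu]_x (`|laplacian u x| ^+ 2)%:E =
  \int[mu]_(x in D) (htr h x ^+ 2)%:E)%E.
Proof.
have ctr : cont_off0 (htr h) by apply: cont_off0_sum => i; exact: c0.
have E x : `|laplacian u x| ^+ 2 = htr h x ^+ 2 by rewrite real_normK // num_real.
under eq_integral do rewrite E.
apply: integral_off0 => //; first exact: cont_off0M.
  by apply: measurable_continuous_off0; exact: cont_off0M.
by move=> x; exact: sqr_ge0.
Qed.

Notation energy s :=
  (\int[mu]_x (enorm (gradient u x) ^+ 2 / enorm x `^ s)%:E)%E.

Lemma integral_energy (s : R) (W : rV -> R) : cont_off0 W ->
  (forall x, x != 0 -> W x = (enorm x `^ s)^-1) ->
  (energy s = \int[mu]_(x in D) (W x * gsqr g x)%:E)%E.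
Proof.
move=> cW WE; apply: integral_off0; first exact: cont_off0M.
- have -> : (fun x : rV => enorm (gradient u x) ^+ 2 / enorm x `^ s) =
      (fun x => gsqr g x * (enorm x `^ s)^-1).
    by apply/funext => x; rewrite gsqr_gradient.
  apply: measurable_continuous_off0; apply: cont_off0M => // x x0.
  have [cP _] := @homogeneous_powR_enorm R n s.
  apply: (@continuousV _ _ (fun x : rV => enorm x `^ s)); last exact: cP.
  by rewrite gt_eqF // powR_gt0 // enorm_gt0.
- by move=> x; rewrite divr_ge0 ?sqr_ge0 // powR_ge0.
- by move=> x x0; rewrite WE // gsqr_gradient mulrC.
Qed.

Let cpow s : cont_off0 (fun x : rV => enorm x `^ s).
Proof. by have [] := @homogeneous_powR_enorm R n s. Qed.

Let powN s (x : rV) : enorm x `^ (- s) = (enorm x `^ s)^-1.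
Proof. by rewrite powRN. Qed.

(** In the sharp constant n + |1 - b| both regimes appear at once: s is the sign
    of 1 - b, and weighted_inequality is used with K = - s n and m = s l. *)
Lemma ckn_L2 b : (forall i, L2 (fun x : rV => enorm x `^ (- b) * g i x)) ->
  (((n%:R + `|1 - b|) / 2)%:E * energy (b + 1) <=
   (\int[mu]_x (`|laplacian u x| ^+ 2)%:E) `^ 2^-1 * energy (2 * b) `^ 2^-1)%E.
Proof.
move=> LW; set W := fun x : rV => enorm x `^ (- b).
have hW : homogeneous (- b) W by exact: homogeneous_powR_enorm.
have W0 x : 0 <= W x by exact: powR_ge0.
have IA := int0_htr n5 M0 ch sh.
have IB := int0_W2_gsqr LW; have IE := int0_W_gsqr n5 M0 cg sg LW.
have cW : cont_off0 W by exact: cpow.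
rewrite integral_laplacian.
rewrite (@integral_energy (2 * b) (fun x => W x ^+ 2)); last 2 first.
- exact: cont_off0M.
- move=> x x0; rewrite -powN /W -powR_mulrn ?powR_ge0 // -powRrM.
  by congr (_ `^ _); ring.
rewrite (@integral_energy (b + 1) (fun x => W x * (enorm x)^-1)); last 2 first.
- by apply: cont_off0M => //; exact: cont_off0_inv_enorm.
- move=> x x0; rewrite -powN opprD powRD ?powR_inv1 ?enorm_ge0 //.
  by rewrite (gt_eqF (enorm_gt0 x0)) implybT.
pose s : R := if b <= 1 then 1 else -1.
have s2 : s ^+ 2 = 1 by rewrite /s; case: ifP => _; ring.
have sb : s * (1 - b) = `|1 - b|.
  rewrite /s; case: leP => b1; first by rewrite mul1r ger0_norm // subr_ge0.
  by rewrite mulN1r ltr0_norm // subr_lt0.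
apply: optimize_scale.
- by rewrite addr_ge0.
- by apply: integral_ge0 => x _; rewrite lee_fin sqr_ge0.
- exact: (integrable_lty mD IA).
- apply: integral_ge0 => x _; rewrite lee_fin mulr_ge0 ?sqr_ge0 //.
  by rewrite gsqr_gradient sqr_ge0.
- exact: (integrable_lty mD IB).
- apply: integral_ge0 => x _; rewrite lee_fin !mulr_ge0 ?invr_ge0 ?enorm_ge0 //.
  by rewrite gsqr_gradient sqr_ge0.
- exact: (integrable_lty mD IE).
move=> l l0.
have mb : 0 <= s * l * (1 - b) by rewrite mulrAC sb mulr_ge0 // ltW.
have K2 : (- (s * n%:R)) ^+ 2 = n%:R ^+ 2 by rewrite sqrrN exprMn s2 mul1r.
have := weighted_inequality n5 M0 dg dh cg ch ck sg sh sk hC kC kCr hW W0 LW mb K2.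
rewrite exprMn s2 mul1r.
rewrite (_ : s * l * (- (s * n%:R) + b - 1) = - (l * (n%:R + `|1 - b|))); last first.
  have -> : s * l * (- (s * n%:R) + b - 1) = - (l * (s ^+ 2 * n%:R + s * (1 - b))) by ring.
  by rewrite s2 sb mul1r.
have fA := integrable_fin_num mD IA; have fB := integrable_fin_num mD IB.
have fE := integrable_fin_num mD IE.
move: fA fB fE => /fineK <- /fineK <- /fineK <-.
by rewrite -!EFinM -!EFinD !lee_fin => H; lra.
Qed.

(** Finiteness of the weighted energy is the only information available near the
    origin when b is large; it is what makes the weighted divergences
    integrable. *)
Lemma L2_energy b : (energy (2 * b) < +oo)%E ->
  forall i, L2 (fun x : rV => enorm x `^ (- b) * g i x).
Proof.
move=> Hb i; have cWg : cont_off0 (fun x : rV => enorm x `^ (- b) * g i x).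
  by apply: cont_off0M; [exact: cpow | exact: c0].
split => //.
have : int0 (fun x : rV => enorm x `^ (- (2 * b)) * gsqr g x).
  apply/integrableP; split.
    apply/measurable_EFinP/measurable_funTS; apply: measurable_continuous_off0.
    exact: cont_off0M.
  move: Hb; rewrite (@integral_energy _ (fun x => enorm x `^ (- (2 * b)))) //.
  congr (is_true (_ < _)%E); apply: eq_integral => x _; rewrite /= ger0_norm //.
  by rewrite mulr_ge0 ?powR_ge0 // gsqr_gradient sqr_ge0.
move=> I; apply: (int0_le (cont_off0M cWg cWg) I) => x x0.
rewrite -expr2 ger0_norm ?sqr_ge0 // exprMn -powR_mulrn ?powR_ge0 // -powRrM.
rewrite (_ : - b * 2%:R = - (2 * b)); last by ring.
rewrite ler_wpM2l ?powR_ge0 // /gsqr (bigD1 i) //= lerDl sumr_ge0 // => j _.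
exact: sqr_ge0.
Qed.

Lemma energy_ge0 s : (0 <= energy s)%E.
Proof. by apply: integral_ge0 => x _; rewrite lee_fin divr_ge0 ?sqr_ge0 ?powR_ge0. Qed.

(** If Delta u vanishes then so does grad u: the case b = -1, whose weighted
    energy is always finite, gives a vanishing integral of |grad u|^2. This
    settles the product 0 * +oo. *)
Lemma laplacian_eq0_energy s :
  (\int[mu]_x (`|laplacian u x| ^+ 2)%:E = 0 -> energy s = 0)%E.
Proof.
move=> A0.
have LW i : L2 (fun x : rV => enorm x `^ (- (-1)) * g i x).
  apply: (@L2_ext _ _ (fun x => enorm x * g i x)).
  - by move=> x _; rewrite opprK powRr1 // enorm_ge0.
  - by apply: cont_off0M; [exact: cpow | exact: c0].
  - apply: (L2_supp n3 M0); last by move=> x l /sg ->; rewrite mulr0.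
    by move=> x; apply: continuousM; [exact: continuous_enorm | exact: cg].
have := ckn_L2 LW; rewrite A0 poweR0r ?invr_neq0 // mul0e.
rewrite pmule_rle0; last by rewrite lte_fin divr_gt0 // ltr_pwDl // ltr0n; exact: ltnW n2.
move=> E0; have {}E0 : (energy (-1 + 1) = 0)%E by apply/eqP; rewrite eq_le E0 energy_ge0.
rewrite (@integral_energy _ (fun=> 1)) in E0; last 2 first.
- exact: cont_off0_cst.
- by move=> x _; rewrite addNr powRr0 invr1.
rewrite (@integral_energy s (fun x => enorm x `^ (- s))) //.
have mg : measurable_fun D (fun x => (1 * gsqr g x)%:E).
  apply/measurable_EFinP/measurable_funTS; apply: measurable_continuous_off0.
  by apply: cont_off0M => //; exact: cont_off0_cst.
rewrite (@ae_eq_integral _ _ _ mu D (cst 0%E)) ?integral0 //.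
  apply/measurable_EFinP/measurable_funTS; apply: measurable_continuous_off0.
  exact: cont_off0M.
have /(ae_eq_integral_abs mu mD mg) : (\int[mu]_(x in D) `|(1 * gsqr g x)%:E| = 0)%E.
  rewrite -[RHS]E0; apply: eq_integral => x _; rewrite /= ger0_norm //.
  by rewrite mul1r gsqr_gradient sqr_ge0.
by apply: filterS => x H /H; rewrite mul1r => -[->]; rewrite mulr0.
Qed.

(** If the weighted energy is infinite, then so is the right-hand side, unless
    Delta u = 0, which laplacian_eq0_energy excludes. *)
Lemma ckn b : (((n%:R + `|1 - b|) / 2)%:E * energy (b + 1) <=
   (\int[mu]_x (`|laplacian u x| ^+ 2)%:E) `^ 2^-1 * energy (2 * b) `^ 2^-1)%E.
Proof.
have [Bfin|] := boolP (energy (2 * b) < +oo)%E.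
  by apply: ckn_L2; exact: L2_energy.
rewrite -leNgt leye_eq => /eqP BE.
have [A0|A0] := eqVneq (\int[mu]_x (`|laplacian u x| ^+ 2)%:E)%E 0%E.
  by have := laplacian_eq0_energy (2 * b) A0; rewrite BE.
rewrite BE poweRyr ?invr_neq0 // gt0_muley ?leey //.
rewrite poweR_gt0 // lt0e A0 /=.
by apply: integral_ge0 => x _; rewrite lee_fin sqr_ge0.
Qed.

End application.

(** * The four inequalities *)

Local Open Scope ereal_scope.

Theorem corollary1p4 (R : realType) (N : nat) (hN : (5 <= N)%N)
    (u : 'rV[R]_N -> R) (u_smooth : smooth u)
    (u_supp : compactly_supported u) :
  (* (a) *)
  ((\int[lebesgue_rV R N]_x (`|laplacian u x| ^+ 2)%:E) `^ 2^-1 *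
   (\int[lebesgue_rV R N]_x (enorm x ^+ 2 * enorm (gradient u x) ^+ 2)%:E)
     `^ 2^-1
   >= ((N%:R + 2) / 2)%:E *
      \int[lebesgue_rV R N]_x (enorm (gradient u x) ^+ 2)%:E)
  /\
  (* (b) *)
  ((\int[lebesgue_rV R N]_x (`|laplacian u x| ^+ 2)%:E) `^ 2^-1 *
   (\int[lebesgue_rV R N]_x (enorm (gradient u x) ^+ 2)%:E) `^ 2^-1
   >= ((N%:R + 1) / 2)%:E *
      \int[lebesgue_rV R N]_x (enorm (gradient u x) ^+ 2 / enorm x)%:E)
  /\
  (* (c) *)
  (forall b : R, (b < 1)%R ->
   (\int[lebesgue_rV R N]_x (`|laplacian u x| ^+ 2)%:E) `^ 2^-1 *
   (\int[lebesgue_rV R N]_x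
      (enorm (gradient u x) ^+ 2 / enorm x `^ (2 * b))%:E) `^ 2^-1
   >= ((N%:R + 1 - b) / 2)%:E *
      \int[lebesgue_rV R N]_x
        (enorm (gradient u x) ^+ 2 / enorm x `^ (b + 1))%:E)
  /\
  (* (d) *)
  (forall b : R, (1 < b)%R ->
   (\int[lebesgue_rV R N]_x (`|laplacian u x| ^+ 2)%:E) `^ 2^-1 *
   (\int[lebesgue_rV R N]_x
      (enorm (gradient u x) ^+ 2 / enorm x `^ (2 * b))%:E) `^ 2^-1
   >= ((N%:R + b - 1) / 2)%:E *
      \int[lebesgue_rV R N]_x
        (enorm (gradient u x) ^+ 2 / enorm x `^ (b + 1))%:E).
Proof.
have main := ckn hN u_smooth u_supp.
have c b : (b < 1)%R -> ((N%:R + 1 - b) / 2 = (N%:R + `|1 - b|) / 2 :> R)%R.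
  by move=> b1; rewrite ger0_norm ?subr_ge0 ?ltW // addrA.
have d b : (1 < b)%R -> ((N%:R + b - 1) / 2 = (N%:R + `|1 - b|) / 2 :> R)%R.
  by move=> b1; rewrite ltr0_norm ?subr_lt0 // opprB addrA.
split; [|split; [|split]].
- have := main (-1)%R; rewrite -c ?ltrN10 //.
  rewrite (_ : N%:R + 1 - -1 = N%:R + 2)%R; last by ring.
  congr (is_true (_ * _ <= _ * _ `^ _)); apply: eq_integral => x _; congr (_%:E).
    by rewrite addNr powRr0 divr1.
  by rewrite mulrN1 powRN invrK powR_mulrn ?enorm_ge0 // mulrC.
- have := main 0%R; rewrite -c ?ltr01 // subr0.
  congr (is_true (_ * _ <= _ * _ `^ _)); apply: eq_integral => x _; congr (_%:E).
    by rewrite add0r powRr1 // enorm_ge0.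
  by rewrite mulr0 powRr0 divr1.
- by move=> b b1; rewrite c.
- by move=> b b1; rewrite d.
Qed.
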